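(* Let $\mathbb{R}$ be equipped with its Borel $\sigma$-algebra. Let $\mathsf{es}_{\mathbb{R}}:\mathbb{R}^{\mathbb{N}}\to\mathbb{R}$ be defined as follows: a sequence $(x_i)\in\mathbb{R}^{\mathbb{N}}$ belongs to the domain of $\mathsf{es}_{\mathbb{R}}$ if and only if the limits $$\lim_{n\to\infty}\frac{|\{i\le n\mid x_i\le t\}|}{n}$$ exist uniformly in $t\in\mathbb{Q}$, and in this case $\mathsf{es}_{\mathbb{R}}(\,\cdot\,|(x_i))$ is the unique probability measure on $\mathbb{R}$ satisfying $$\mathsf{es}_{\mathbb{R}}\bigl(T\,|\,(x_i)\bigr)=\lim_{n\to\infty}\frac{|\{i\le n\mid x_i\in T\}|}{n}$$ for all intervals $T\subseteq\mathbb{R}$. Then $\mathsf{es}_{\mathbb{R}}$ is an empirical sampling morphism for $\mathbb{R}$ in $\mathsf{Partial}(\mathsf{BorelStoch})$.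
   Context: $\mathbb{N}=\{1,2,3,\ldots\}$. $\mathsf{Partial}(\mathsf{BorelStoch})$ has standard Borel spaces as objects. A morphism $f:X\to Y$ is a partial Markov kernel: a measurable set $D_f\subseteq X$ (its domain) together with a Markov kernel $f(\cdot|x)$, $x\in D_f$, from $D_f$ to $Y$. The composite of $f:X\to Y$ and $g:Y\to Z$ has domain $D_{gf}=\{x\in D_f\mid f(D_g|x)=1\}$ and on it $(gf)(S|x)=\int_{D_g}g(S|y)\,f(dy|x)$. The tensor product of objects is the cartesian product with product $\sigma$-algebra; $f\otimes g$ for $f:A\to X$, $g:B\to Y$ has domain $D_f\times D_g$ and is given there by product measures. Two morphisms are equal iff they have the same domain and the same kernel on it. The Kolmogorov power $X^{\mathbb{N}}$ is the countable product with product $\sigma$-algebra. For a morphism $f:A\to X$, $f^{(\mathbb{N})}:A\to X^{\mathbb{N}}$ has domain $D_f$ and sends $a$ to the infinite product measure $f(\cdot|a)^{\otimes\mathbb{N}}$. For a finite permutation $\sigma$ of $\mathbb{N}$ (a bijection fixing all but finitely many elements), $X^\sigma:X^{\mathbb{N}}\to X^{\mathbb{N}}$ is the (everywhere defined) deterministic kernel given by $(x_i)\mapsto(x_{\sigma(i)})$. A morphism $f:A\to X^{\mathbb{N}}\otimes Y$ is exchangeable in the first factor if $(X^\sigma\otimes \mathrm{id}_Y)\,f=f$ for every finite permutation $\sigma$. An empirical sampling morphism for $X$ is a morphism $\mathsf{es}:X^{\mathbb{N}}\to X$ (so in particular its domain is measurable and it is a Markov kernel on it) such that: (i) (permutation invariance)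 $\mathsf{es}\,X^\sigma=\mathsf{es}$ for every finite permutation $\sigma$ of $\mathbb{N}$; (ii) (empirical adequacy) for all objects $A,Y$ and every morphism $f:A\to X^{\mathbb{N}}\otimes Y$ exchangeable in the first factor, $(\mathsf{es}^{(\mathbb{N})}\otimes \mathrm{id}_Y)\,f=f$. *)

(* Defs.v *)
From HB Require Import structures.
From mathcomp Require Import all_boot all_order all_algebra.
From mathcomp Require Import all_classical all_reals all_analysis.
From mathcomp Require Import measurable_realfun giry.

Set Implicit Arguments.
Unset Strict Implicit.
Unset Printing Implicit Defensive.

Import Order.TTheory GRing.Theory Num.Theory.
Import numFieldNormedType.Exports.

Local Open Scope classical_set_scope.
Local Open Scope ring_scope.

(* The carrier of a measurableType is inhabited, but the empty set is a standard
   Borel space.  A measurable space is therefore represented by a measurable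
   set [pts] of a measurableType, with the trace sigma-algebra; [pts] may be
   empty. *)
Record mspace := MSpace {
  mdisp : measure_display ;
  mcarrier :> measurableType mdisp ;
  pts : set mcarrier ;
  measurable_pts : measurable pts }.

Arguments pts : clear implicits.
Arguments measurable_pts : clear implicits.

(* [phi] is an isomorphism of measurable spaces from [pts X] onto a Borel subset
   of a Polish space. *)
Definition standard_borel (R : realType) (X : mspace) : Prop :=
  exists (P : completePseudoMetricType R) (phi : X -> P),
    (hausdorff_space P /\ exists2 D : set P, countable D & dense D) /\
    [/\ {in pts X &, injective phi},
        <<s (@open P) >> (phi @` pts X) &
        forall U : set X, U `<=` pts X ->
          (measurable U <-> <<s (@open P) >> (phi @` U))].

Definition mreal (R : realType) : mspace :=
  @MSpace default_measure_display R setT measurableT.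

Lemma standard_borel_mreal (R : realType) : standard_borel R (mreal R).
Proof.
have mE : @measurable _ R = <<s (@open R) >>.
  apply/seteqP; split; last first.
    apply: smallest_sub; first exact: sigma_algebra_measurable.
    exact: open_measurable.
  rewrite [X in X `<=` _](RGenOpens.measurableE R).
  apply: smallest_sub; first exact: smallest_sigma_algebra.
  move=> _ [x [y ->]]; apply: sub_sigma_algebra; exact: interval_open.
exists R, id; split; last split => //.
- split; first exact: Rhausdorff.
  exists (@ratr R @` setT); last exact: dense_rat.
  apply: (card_le_trans (card_image_le _ _)); exact: countableP.
- by rewrite image_id -mE; exact: measurableT.
- by move=> U _; rewrite image_id -mE.
Qed.

Definition mprod (X Y : mspace) : mspace :=
  @MSpace (measure_prod_display (mdisp X, mdisp Y)) (X * Y)%type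
    (pts X `*` pts Y) (measurableX (measurable_pts X) (measurable_pts Y)).

Section kolmogorov_power.
Variable X : mspace.

Definition coord_preimages : set (set (nat -> X)) :=
  \bigcup_(i in [set: nat])
    preimage_set_system setT (fun x : nat -> X => x i) measurable.

Definition seqs := g_sigma_algebraType coord_preimages.

Lemma measurable_coord (i : nat) :
  measurable_fun [set: seqs] (fun x : seqs => x i : X).
Proof.
move=> _ U mU; apply: sub_sigma_algebra; exists i => //.
by exists U.
Qed.

Lemma measurable_seqs_pts : measurable [set x : seqs | forall i, pts X (x i)].
Proof.
rewrite [X in measurable X](_ : _ = \bigcap_i ((fun x : seqs => x i : X) @^-1` pts X)).
  apply: bigcapT_measurable => i; rewrite -[X in measurable X]setTI.
  by apply: measurable_coord => //; exact: measurable_pts.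
by apply/seteqP; split => x /= h => [i _|i]; exact: h.
Qed.

(* The factors are indexed by nat = {0, 1, ...} instead of {1, 2, ...}. *)
Definition mpow : mspace := MSpace measurable_seqs_pts.

End kolmogorov_power.

(* A partial Markov kernel.  [ker x] is irrelevant when [x] is outside [dom]:
   see [peq]. *)
Record pker (R : realType) (X Y : mspace) := PKer {
  dom : set X ;
  ker :> X -> probability Y R ;
  measurable_dom : measurable dom ;
  dom_sub : dom `<=` pts X ;
  ker_pts : forall x, dom x -> ker x (pts Y) = 1%E ;
  measurable_ker : forall U : set Y, measurable U ->
    measurable_fun dom (fun x => ker x U) }.

Arguments measurable_dom {R X Y} _.
Arguments measurable_ker {R X Y} _ {U}.

Definition peq (R : realType) (X Y : mspace) (f g : pker R X Y) : Prop :=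
  dom f = dom g /\
  forall x, dom f x -> forall U : set Y, measurable U -> f x U = g x U.

Section deterministic.
Variables (R : realType) (X Y : mspace) (h : X -> Y).
Hypotheses (mh : measurable_fun [set: X] h)
  (hpts : forall x, pts X x -> pts Y (h x)).

Let det_ker (x : X) : probability Y R := dirac (h x).

Let det_ker_pts x : pts X x -> det_ker x (pts Y) = 1%E.
Proof. by move=> /hpts hx; rewrite [LHS]diracE mem_set. Qed.

Let measurable_det_ker (U : set Y) : measurable U ->
  measurable_fun (pts X) (fun x => det_ker x U).
Proof.
move=> mU; apply: (measurable_funS measurableT) => //.
apply: (@measurableT_comp _ _ _ _ _ _ (fun y => @dirac _ Y y R U)) => //.
exact: measurable_fun_dirac.
Qed.

Definition pdet : pker R X Y :=
  @PKer R X Y (pts X) det_ker (measurable_pts X) (fun=> id) det_ker_pts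
    measurable_det_ker.

End deterministic.

Definition pid (R : realType) (X : mspace) : pker R X X :=
  @pdet R X X idfun (@measurable_id _ X setT) (fun=> id).

Section permutation.
Variables (R : realType) (X : mspace) (s : nat -> nat).

Let reindex (x : mpow X) : mpow X := x \o s.

Let measurable_reindex : measurable_fun [set: mpow X] reindex.
Proof.
apply: (@measurability _ _ (mpow X) (mpow X) setT reindex (@coord_preimages X)) => //.
move=> _ [_ [i _ [U mU <-]] <-]; rewrite !setTI.
rewrite (_ : _ @^-1` _ = (fun x : seqs X => x (s i) : X) @^-1` U) //.
by rewrite -[X in measurable X]setTI; exact: measurable_coord.
Qed.

Let reindex_pts x : pts (mpow X) x -> pts (mpow X) (reindex x).
Proof. by move=> hx i; exact: hx. Qed.

Definition pperm : pker R (mpow X) (mpow X) :=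
  pdet R measurable_reindex reindex_pts.

End permutation.

Section composition.
Variables (R : realType) (X Y Z : mspace) (g : pker R Y Z) (f : pker R X Y).
Local Open Scope ereal_scope.

Definition pcomp_dom : set X := [set x | dom f x /\ f x (dom g) = 1].

Definition pcomp_int (x : X) (S : set Z) : \bar R :=
  \int[f x]_(y in dom g) g y S.

Let pcomp_int0 x : pcomp_int x set0 = 0.
Proof. by rewrite /pcomp_int integral0_eq. Qed.

Let pcomp_int_ge0 x S : 0 <= pcomp_int x S.
Proof. exact: integral_ge0. Qed.

Let pcomp_int_sigma_additive x : semi_sigma_additive (pcomp_int x).
Proof.
move=> F mF tF mUF; rewrite [X in _ --> X](_ : _ =
    \int[f x]_(y in dom g) \sum_(0 <= k <oo) g y (F k)); last first.
  apply: eq_integral => y _; apply/esym/cvg_lim => //.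
  exact: measure_semi_sigma_additive.
rewrite [X in X @ _](_ : _ =
    (fun n => \int[f x]_(y in dom g) \sum_(0 <= k < n) g y (F k))); last first.
  apply/funext => n; rewrite ge0_integral_sum//; first exact: measurable_dom.
  by move=> k; exact: measurable_ker.
apply: cvg_monotone_convergence => //.
- exact: measurable_dom.
- by move=> n; apply: emeasurable_sum => k; exact: measurable_ker.
- by move=> n y _; rewrite sume_ge0.
- by move=> y _ m n mn; exact: ereal_nondecreasing_series.
Qed.

HB.instance Definition _ x := isMeasure.Build _ _ _ (pcomp_int x)
  (pcomp_int0 x) (pcomp_int_ge0 x) (@pcomp_int_sigma_additive x).

(* [pcomp_int x] has mass 1 when [x] is in [pcomp_dom], so that normalising it
   only changes the irrelevant values: see [pcompE]. *)
Let pcomp_ker (x : X) : probability Z R := mnormalize (pcomp_int x) (dirac point).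

Let pcomp_int_full x S : measurable S -> pcomp_dom x ->
  (forall y, dom g y -> g y S = 1) -> pcomp_int x S = 1.
Proof.
move=> mS [_ fx1] gS.
rewrite /pcomp_int (eq_integral (cst 1)) => [|y /set_mem]; last exact: gS.
by rewrite integral_cst ?mul1e//; exact: measurable_dom.
Qed.

Let pcomp_kerE x S : pcomp_dom x -> pcomp_ker x S = pcomp_int x S.
Proof.
move=> dx; rewrite /pcomp_ker /= /mnormalize/= pcomp_int_full//; last first.
  by move=> y _; exact: probability_setT.
by rewrite onee_eq0/= invr1 mule1.
Qed.

Let measurable_ker_giry :
  measurable_fun (dom f) (fun x => f x : giry Y R).
Proof.
apply: measurable_giry_codensity; first exact: measurable_dom.
by move=> B mB; exact: measurable_ker.
Qed.

Let measurable_pcomp_int S : measurable S ->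
  measurable_fun (dom f) (fun x => pcomp_int x S).
Proof.
move=> mS; pose k := (fun y => g y S) \_ (dom g).
rewrite (_ : (fun _ => _) = (@giry_int _ _ R ^~ k) \o (fun x => f x : giry Y R)).
  apply: (measurable_comp measurableT) => //.
  apply: measurable_giry_int.
    apply/(measurable_restrictT _ _).1; first exact: measurable_dom.
    exact: measurable_ker.
  by move=> y; rewrite /k patchE; case: ifP.
by apply/funext => x; rewrite /pcomp_int integral_mkcond.
Qed.

Let measurable_pcomp_dom : measurable pcomp_dom.
Proof.
have mf1 := measurable_ker f (measurable_dom g).
have := mf1 (measurable_dom f) [set 1] (emeasurable_set1 _).
by rewrite (_ : _ `&` _ = pcomp_dom).
Qed.

Let pcomp_dom_sub : pcomp_dom `<=` pts X.
Proof. by move=> x [/dom_sub]. Qed.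

Let pcomp_ker_pts x : pcomp_dom x -> pcomp_ker x (pts Z) = 1.
Proof.
move=> dx; rewrite pcomp_kerE// pcomp_int_full//; first exact: measurable_pts.
by move=> y; exact: ker_pts.
Qed.

Let measurable_pcomp_ker S : measurable S ->
  measurable_fun pcomp_dom (fun x => pcomp_ker x S).
Proof.
move=> mS; apply: (eq_measurable_fun (fun x => pcomp_int x S)).
  by move=> x /set_mem dx; rewrite pcomp_kerE.
apply: (measurable_funS (measurable_dom f)); first by move=> x [].
exact: measurable_pcomp_int.
Qed.

Definition pcomp : pker R X Z := PKer measurable_pcomp_dom pcomp_dom_sub
  pcomp_ker_pts measurable_pcomp_ker.

Lemma pcompE x S : dom pcomp x -> pcomp x S = \int[f x]_(y in dom g) g y S.
Proof. exact: pcomp_kerE. Qed.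

End composition.

Section tensor.
Variables (R : realType) (A B X Y : mspace) (f : pker R A X) (g : pker R B Y).
Local Open Scope ereal_scope.

Let ptensor_dom : set (mprod A B) := dom f `*` dom g.

Let ptensor_ker (ab : mprod A B) : probability (mprod X Y) R :=
  f ab.1 \x g ab.2.

Let measurable_ptensor_dom : measurable ptensor_dom.
Proof. by apply: measurableX; exact: measurable_dom. Qed.

Let ptensor_dom_sub : ptensor_dom `<=` pts (mprod A B).
Proof. by move=> [a b] [/dom_sub ? /dom_sub ?]. Qed.

Let ptensor_ker_pts ab : ptensor_dom ab -> ptensor_ker ab (pts (mprod X Y)) = 1.
Proof.
move=> [da db]; transitivity (f ab.1 (pts X) * g ab.2 (pts Y)).
  by apply: product_measure1E; exact: measurable_pts.
by rewrite !ker_pts ?mule1.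
Qed.

Let measurable_ptensor_ker (U : set (mprod X Y)) : measurable U ->
  measurable_fun ptensor_dom (fun ab => ptensor_ker ab U).
Proof.
move=> mU.
pose f' := (fun a => f a : giry X R) \_ (dom f).
pose g' := (fun b => g b : giry Y R) \_ (dom g).
have mf' : measurable_fun [set: A] f'.
  apply/(measurable_restrictT _ _).1; first exact: measurable_dom.
  apply: measurable_giry_codensity; first exact: measurable_dom.
  by move=> V mV; exact: measurable_ker.
have mg' : measurable_fun [set: B] g'.
  apply/(measurable_restrictT _ _).1; first exact: measurable_dom.
  apply: measurable_giry_codensity; first exact: measurable_dom.
  by move=> V mV; exact: measurable_ker.
apply: (eq_measurable_fun (fun ab : A * B => giry_prod (f' ab.1, g' ab.2) U)).
  move=> [a b] /set_mem [/= da db].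
  by rewrite /f' /g' !patchE !mem_set.
apply: (measurable_funS measurableT) => //.
pose h (ab : A * B) : giry X R * giry Y R := (f' ab.1, g' ab.2).
have mh : measurable_fun [set: A * B] h.
  by apply: measurable_fun_pair; apply: measurableT_comp.
exact: (measurableT_comp (measurable_giry_ev mU)
  (measurableT_comp (@measurable_giry_prod _ _ X Y R) mh)).
Qed.

Definition ptensor : pker R (mprod A B) (mprod X Y) :=
  PKer measurable_ptensor_dom ptensor_dom_sub ptensor_ker_pts
    measurable_ptensor_ker.

End tensor.

(* [mu] is the infinite product of copies of [P]; measurable rectangles form a
   pi-system generating the sigma-algebra of X^N, so there is at most one such
   [mu] up to equality on measurable sets. *)
Definition is_iprod (R : realType) (X : mspace) (P : probability X R)
    (mu : probability (mpow X) R) : Prop :=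
  forall (n : nat) (S : nat -> set X), (forall i, measurable (S i)) ->
    mu [set x | forall i, (i < n)%N -> S i (x i)] = (\prod_(i < n) P (S i))%E.

(* [fN] is f^(N); this determines [fN] up to [peq]. *)
Definition is_ppow (R : realType) (A X : mspace) (f : pker R A X)
    (fN : pker R A (mpow X)) : Prop :=
  dom fN = dom f /\ forall a, dom f a -> is_iprod (f a) (fN a).

Definition finite_perm (s : nat -> nat) : Prop :=
  bijective s /\ finite_set [set i | s i <> i].

Definition exchangeable1 (R : realType) (A X Y : mspace)
    (f : pker R A (mprod (mpow X) Y)) : Prop :=
  forall s, finite_perm s ->
    peq (pcomp (ptensor (pperm R X s) (pid R Y)) f) f.

Definition permutation_invariant (R : realType) (X : mspace)
    (es : pker R (mpow X) X) : Prop :=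
  forall s, finite_perm s -> peq (pcomp es (pperm R X s)) es.

Definition empirically_adequate (R : realType) (X : mspace)
    (es : pker R (mpow X) X) : Prop :=
  exists2 esN : pker R (mpow X) (mpow X), is_ppow es esN &
    forall A Y : mspace, standard_borel R A -> standard_borel R Y ->
    forall f : pker R A (mprod (mpow X) Y), exchangeable1 f ->
      peq (pcomp (ptensor esN (pid R Y)) f) f.

Definition empirical_sampling (R : realType) (X : mspace)
    (es : pker R (mpow X) X) : Prop :=
  permutation_invariant es /\ empirically_adequate es.

Section real_sampling.
Variable R : realType.

(* The proportion of the first [n] terms of [x] that lie in [T]. *)
Definition relfreq (x : nat -> R) (T : set R) (n : nat) : R :=
  #|[pred i : 'I_n | x i \in T]|%:R / n%:R.

Definition esR_dom : set (mpow (mreal R)) :=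
  [set x | exists F : rat -> R,
     {uniform, (fun n (t : rat) => relfreq x `]-oo, ratr t] n) @ \oo --> F}].

Definition esR_measure (x : mpow (mreal R)) (mu : probability (mreal R) R) :=
  forall T : set R, is_interval T ->
    (relfreq x T n)%:E @[n --> \oo] --> mu T.

Definition is_esR (es : pker R (mpow (mreal R)) (mreal R)) : Prop :=
  dom es = esR_dom /\ forall x, esR_dom x -> esR_measure x (es x).

End real_sampling.

(* Main.v *)
From HB Require Import structures.
Require Import Defs.
From mathcomp Require Import all_boot all_order all_algebra.
From mathcomp Require Import all_classical all_reals all_analysis.
From mathcomp Require Import measurable_realfun.
From mathcomp Require Import ring lra zify.

Set Implicit Arguments.
Unset Strict Implicit.
Unset Printing Implicit Defensive.

Import Order.TTheory GRing.Theory Num.Theory.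
Import numFieldNormedType.Exports.

Local Open Scope classical_set_scope.
Local Open Scope ring_scope.

(** Why the theorem is true.

    A sequence is in the domain exactly when its empirical distribution
    functions converge uniformly on the whole line: a finite sample cannot
    distinguish a real threshold from a slightly larger rational one
    ([esR_dom_cauchy]).  Uniformity is what makes the limit a distribution
    function: mass cannot escape to infinity, right-continuity survives, and
    left limits converge as well, so that the frequency of every interval
    converges to its mass ([ex_esR_measure]).  A finite permutation does not
    change the frequencies of long initial segments, whence permutation
    invariance.

    The kernel es^(N) needs infinite product measures.  The binary digits of a
    uniform variable are fair coins, and a sequence of coins splits into its
    even and odd parts, two independent sequences with the law of the whole.
    Iterating the splitting gives infinitely many independent uniform variables
    ([ex_iid_uniform]), and quantile functions turn them into independent
    variables of any law ([ex_iprod]).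

    Empirical adequacy has two halves.  First, an exchangeable sequence is
    almost surely in the domain ([exchangeable_ecdf_cauchy]).  Compare the
    samples of sizes n = (k+1)^8 and m = (k+2)^8 with L = (k+2)^2 thresholds at
    the empirical quantiles of the larger sample.  These thresholds are symmetric
    functions of the m observations, so the events that the i-th observation lies
    below a threshold are exchangeable, and the frequencies of such events in
    the two samples differ by a variable of second moment at most 1/n
    ([prob_avg_diff]).  By Chebyshev and Borel-Cantelli all these differences
    are eventually at most 1/L; by monotonicity the two distribution functions
    are then within 2/L of each other everywhere ([ecdf_sandwich]).  Since 2/L is
    summable over k and consecutive checkpoints have ratio tending to 1, the
    empirical distribution functions are uniformly Cauchy
    ([ecdf_cauchy_of_steps]).

    Second, conditionally on the empirical law the coordinates are independent
    with that law.  Let H be bounded and invariant under the transpositions of k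
    with any j >= k.  Then H 1_S(x_j) has the same mean for all j >= k, hence
    the same mean as H times the frequency of S, which converges to H es(S)
    ([Rintegral_directing_measure]).  Replacing one factor 1_{S_k}(x_k) after
    another by es(S_k) gives the identity on cylinders
    ([directing_measure_product]), and cylinders determine the measure.
    The permutations act trivially on the factor Y, which is therefore carried
    along inside H. *)

(** * Laws, joint laws and self-similar splittings *)

Section probability_tools.
Variable R : realType.
Local Open Scope ereal_scope.

(** The pi-system need not contain the whole space, which is why equality of the
    total masses is a separate hypothesis: half-lines are such a pi-system. *)
Lemma eq_measure_pi d (T : measurableType d) (G : set (set T))
    (m1 m2 : {measure set T -> \bar R}) :
  @measurable _ T = <<s G >> -> setI_closed G ->
  m1 setT = m2 setT -> m1 setT < +oo ->
  (forall A, G A -> m1 A = m2 A) ->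
  forall A, measurable A -> m1 A = m2 A.
Proof.
move=> mE GI mT moo mG A mA.
pose H := [set X | G X /\ X `<=` [set: T]].
have HG : H = G by apply/seteqP; split => [X []|X GX].
apply: (@g_sigma_algebra_measure_unique_trace _ R T G setT) => //.
- by move=> X [GX _]; rewrite mE; exact: sub_sigma_algebra.
- by rewrite -/H HG.
- by move=> X [GX _]; exact: mG.
- by rewrite -/H HG -mE.
Qed.

Lemma prob1_setI d (T : measurableType d) (P : probability T R) (A E : set T) :
  measurable A -> measurable E -> P E = 1 -> P (A `&` E) = P A.
Proof.
move=> mA mE PE; rewrite (measureDI P mA mE) [X in X + _](_ : _ = 0) ?add0e//.
apply/eqP; rewrite -measure_le0 -[leRHS](subee (x := 1))// -{2}PE.
rewrite -probability_setC//; apply: le_measure; rewrite ?inE//.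
- exact: measurableD.
- exact: measurableC.
Qed.

Section law.
Context d1 d2 (T1 : measurableType d1) (T2 : measurableType d2).
Variables (P : probability T1 R) (f : T1 -> T2).
Hypothesis mf : measurable_fun [set: T1] f.

HB.instance Definition _ := isMeasurableFun.Build _ _ _ _ f mf.

Definition law : probability T2 R := distribution P (f : {RV P >-> T2}).

Lemma lawE A : law A = P (f @^-1` A). Proof. by []. Qed.

End law.
Arguments law {d1 d2 T1 T2}.

(** Two applications of uniqueness of measures, first in A for a fixed generator B,
    then in B for an arbitrary measurable A. *)
Lemma joint_law_pi d d1 d2 (T : measurableType d) (T1 : measurableType d1)
    (T2 : measurableType d2) (P : probability T R) (f : T -> T1) (g : T -> T2)
    (P1 : probability T1 R) (P2 : probability T2 R) G1 G2 :
  measurable_fun setT f -> measurable_fun setT g ->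
  @measurable _ T1 = <<s G1 >> -> setI_closed G1 -> G1 setT ->
  @measurable _ T2 = <<s G2 >> -> setI_closed G2 -> G2 setT ->
  (forall A B, G1 A -> G2 B -> P (f @^-1` A `&` g @^-1` B) = P1 A * P2 B) ->
  forall A B, measurable A -> measurable B ->
    P (f @^-1` A `&` g @^-1` B) = P1 A * P2 B.
Proof.
move=> mf mg mE1 I1 T1G mE2 I2 T2G h.
have mfA A : measurable A -> measurable (f @^-1` A).
  by move=> mA; rewrite -[_ @^-1` _]setTI; exact: mf.
have mgB B : measurable B -> measurable (g @^-1` B).
  by move=> mB; rewrite -[_ @^-1` _]setTI; exact: mg.
have cE d' (T' : measurableType d') (Q : probability T' R) (B : set T')
    (Q0 : (0 <= fine (Q B))%R) : measurable B ->
    ((NngNum Q0)%:num)%:E = Q B.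
  by move=> mB; rewrite /= fineK// fin_num_measure.
have h1 A B : measurable A -> G2 B ->
    P (f @^-1` A `&` g @^-1` B) = P1 A * P2 B.
  move=> mA GB.
  have mB : measurable B by rewrite mE2; exact: sub_sigma_algebra.
  pose m1 := measure_function_pushforward__canonical__measure_function_Measure
    (mrestr P (mgB _ mB)) mf.
  pose m2 : {measure set T1 -> \bar R} :=
    mscale (NngNum (fine_ge0 (measure_ge0 P2 B))) P1.
  have m2E X : m2 X = P1 X * P2 B by rewrite /m2 /= /mscale cE// muleC.
  rewrite -m2E -[LHS]/(m1 A); apply: (eq_measure_pi mE1 I1) => //.
  - by rewrite m2E; exact: h.
  - rewrite (le_lt_trans (probability_le1 _ _)) ?ltry//.
    by apply: measurableI; [exact: (mfA _ _)|exact: (mgB _ _)].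
  - by move=> X GX; rewrite m2E; exact: h.
move=> A B mA mB.
pose m1 := measure_function_pushforward__canonical__measure_function_Measure
  (mrestr P (mfA _ mA)) mg.
pose m2 : {measure set T2 -> \bar R} := mscale (NngNum (fine_ge0 (measure_ge0 P1 A))) P2.
have m2E X : m2 X = P1 A * P2 X by rewrite /m2 /= /mscale cE.
rewrite setIC -m2E -[LHS]/(m1 B); apply: (eq_measure_pi mE2 I2) => //.
- by rewrite m2E -h1// setIC.
- rewrite (le_lt_trans (probability_le1 _ _)) ?ltry//.
  by apply: measurableI; [exact: (mgB _ _)|exact: (mfA _ _)].
- by move=> X GX; rewrite m2E -h1// setIC.
Qed.

(** If a point w splits into an observation h w and a remainder t w that are
    independent and the remainder has the law of the whole, then the same holds
    for the remainder, and the observations h w, h (t w), h (t (t w)), ... are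
    independent and identically distributed.  It is used both for the binary digits of
    a uniform variable and for the even and odd parts of a sequence of coins. *)
Lemma iter_split_independent d dX (T : measurableType d)
    (X : measurableType dX) (P : probability T R) (h : T -> X) (t : T -> T) 
    (Q : probability X R) :
  measurable_fun setT h -> measurable_fun setT t ->
  (forall A B, measurable A -> measurable B ->
    P (h @^-1` A `&` t @^-1` B) = Q A * P B) ->
  forall n (S : nat -> set X), (forall i, measurable (S i)) ->
    P [set w | forall i, (i < n)%N -> S i (h (iter i t w))] =
    \prod_(i < n) Q (S i).
Proof.
move=> mh mt ht; have mhit i : measurable_fun setT (fun w => h (iter i t w)).
  suff mit : measurable_fun setT (iter i t).
    exact: (measurableT_comp mh mit).
  elim: i => [|i ih]; first exact: measurable_id.
  exact: (measurableT_comp mt ih).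
elim=> [|n ih] S mS.
  by rewrite big_ord0 -(probability_setT P); congr (P _); apply/seteqP; split.
rewrite big_ord_recl -(ih (fun i => S i.+1))// -ht//; last first.
  rewrite (_ : mkset _ = \bigcap_(i in `I_n)
      (fun w => h (iter i t w)) @^-1` S i.+1) //.
  apply: bigcap_measurableType => i _.
  by rewrite -[X in measurable X]setTI; exact: mhit.
congr (P _); apply/seteqP; split => w /=.
  by move=> hw; split => [|i iln]; [exact: (hw 0%N)|rewrite -iterSr; exact: hw].
by move=> [h0 hS] [|i] // iln; rewrite iterSr; exact: hS.
Qed.

End probability_tools.
Arguments law {R d1 d2 T1 T2}.

(** * The uniform distribution and the doubling map *)

Section rays.
Variable R : realType.

Definition rays : set (set R) := [set A | exists u, A = `]-oo, u]%classic].

Lemma measurable_rays : @measurable _ R = <<s rays >>.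
Proof.
rewrite [LHS](RGenOInfty.measurableE R); apply/seteqP; split.
  apply: smallest_sub; first exact: smallest_sigma_algebra.
  move=> _ [x ->]; rewrite -setCitvl -setTD.
  have [_ h _] := smallest_sigma_algebra [set: R] rays.
  by apply: h; apply: sub_sigma_algebra; exists x.
rewrite -(RGenOInfty.measurableE R).
apply: smallest_sub; first exact: (@sigma_algebra_measurable _ R).
by move=> _ [x ->]; exact: (@measurable_itv R).
Qed.

Lemma setI_rays : setI_closed rays.
Proof.
move=> _ _ [u ->] [v ->]; exists (Num.min u v); apply/seteqP; split => x /=.
  by rewrite !in_itv/= le_min => -[-> ->].
by rewrite !in_itv/= le_min => /andP[].
Qed.

(** [joint_law_pi] needs the whole space among the generators. *)
Definition rays_setT : set (set R) := rays `|` [set setT].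

Lemma measurable_rays_setT : @measurable _ R = <<s rays_setT >>.
Proof.
apply/seteqP; split.
  rewrite measurable_rays; apply: smallest_sub.
    exact: smallest_sigma_algebra.
  by move=> A rA; apply: sub_sigma_algebra; left.
apply: smallest_sub; first exact: (@sigma_algebra_measurable _ R).
by move=> _ [[x ->]|->]; [exact: (@measurable_itv R)|exact: measurableT].
Qed.

Lemma setI_rays_setT : setI_closed rays_setT.
Proof.
move=> A B [rA|->]; last by rewrite setTI.
by move=> [rB|->]; [left; exact: setI_rays|rewrite setIT; left].
Qed.

End rays.

Section uniform.
Variable R : realType.

Definition unif : probability R R :=
  law (uniform_prob (@ltr01 R)) (idfun : measurableTypeR R -> R)
    (@measurable_id _ (measurableTypeR R) setT).

Lemma unifE (A : set R) : measurable A ->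
  unif A = lebesgue_measure (A `&` `[0, 1]%classic : set (measurableTypeR R)).
Proof.
move=> mA.
rewrite /unif lawE preimage_id /= /uniform_prob integral_uniform_pdf.
rewrite (eq_integral (fun=> 1%E)) => [|x]; last first.
  by rewrite inE => -[_]; rewrite /= /uniform_pdf in_itv/= => ->; rewrite subr0 invr1.
rewrite integral_cst ?mul1e//; apply: measurableI => //; exact: measurable_itv.
Qed.

Lemma unif_itv (A : set R) (i : interval R) : measurable A ->
  A `&` `[0, 1]%classic = [set` i] ->
  unif A = (if i.1 < i.2 then (i.2 : \bar R) - i.1 else 0)%E.
Proof. by move=> mA Ai; rewrite unifE// Ai lebesgue_measure_itv. Qed.

Lemma unif_ray u : 0 <= u <= 1 -> unif `]-oo, u]%classic = u%:E.
Proof.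
move=> /andP[u0 u1]; rewrite (@unif_itv _ `[0, u]) => //; last first.
  apply/seteqP; split => x /=; rewrite !in_itv/=.
    by move=> [-> /andP[->]].
  by move=> /andP[-> xu]; rewrite xu (le_trans xu).
rewrite /= lte_fin; case: ltP => [_|u0']; first by rewrite -EFinB subr0.
by congr EFin; apply/eqP; rewrite eq_le u0 u0'.
Qed.

Lemma unif_itv01 : unif `]0, 1[%classic = 1%E.
Proof.
rewrite (@unif_itv _ `]0, 1[) => //=.
  by rewrite lte_fin ltr01 -EFinB subr0.
apply/seteqP; split => x /=; rewrite !in_itv/=; first by case.
by move=> /andP[h1 h2]; rewrite h1 h2 !ltW.
Qed.

Definition digit (w : R) : bool := 2^-1 <= w.
Definition doubling (w : R) : R := 2 * w - (digit w)%:R.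

Lemma measurable_digit : measurable_fun setT digit.
Proof. exact: measurable_fun_ler. Qed.

Lemma measurable_doubling : measurable_fun setT doubling.
Proof.
apply: measurable_funB; first exact: measurable_funM.
rewrite (_ : (fun w => _) = \1_(digit @^-1` [set true])).
  apply: measurable_indic; rewrite -[X in measurable X]setTI.
  exact: measurable_digit.
by apply/funext => w; rewrite indicE; case: (boolP (digit w)) => h /=;
  [rewrite mem_set | rewrite memNset//= (negbTE h)].
Qed.


(** The doubling map is affine with slope 2 on each half of the unit interval, so
    the first binary digit is fair and independent of the remaining ones. *)
Lemma doubling_half (e : bool) (B : set R) : rays_setT B ->
  unif (digit @^-1` [set e] `&` doubling @^-1` B) = ((2^-1)%:E * unif B)%E.
Proof.
have mD (C : set R) : measurable C ->
    measurable (digit @^-1` [set e] `&` doubling @^-1` C).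
  by move=> mC; apply: measurableI; rewrite -[X in measurable X]setTI;
    [exact: measurable_digit|exact: measurable_doubling].
have full (C : set R) : measurable C -> `[0, 1]%classic `<=` C ->
    unif (digit @^-1` [set e] `&` doubling @^-1` C) = ((2^-1)%:E * unif C)%E.
  move=> mC C01.
  rewrite [in RHS](@unif_itv _ `[0, 1]) => //; last by apply/setIidr.
  rewrite (@unif_itv _ (if e then `[2^-1, 1] else `[0, 2^-1[)) => //.
  - case: (e) => /=; rewrite !lte_fin ltr01 -!EFinB -EFinM.
      by rewrite ifT; [congr EFin; lra | lra].
    by rewrite ifT; [congr EFin; lra | lra].
  - exact: mD.
  - apply/seteqP; split => w /=.
      move=> [[<- _]]; rewrite /digit; case: leP => hw; rewrite !in_itv/=; lra.
    rewrite /doubling => h.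
    have de : digit w = e.
      move: h; rewrite /digit; case: (e) => /=; rewrite in_itv/= => h.
        by apply/idP; lra.
      by apply/negbTE; rewrite -ltNge; lra.
    split; first split => //.
      apply: C01; rewrite /= de in_itv/=; move: h; case: (e) => /=; rewrite in_itv/=; lra.
    by move: h; case: (e) => /=; rewrite !in_itv/=; lra.
move=> [[u ->]|->]; last by apply: full => //.
have mu : measurable (`]-oo, u]%classic : set R) by exact: measurable_itv.
have [u1|u1] := leP 1 u.
  by apply: full => // w /=; rewrite !in_itv/= => /andP[_ /le_trans]; exact.
have [u0|u0] := leP 0 u.
  rewrite [in RHS]unif_ray ?u0 ?ltW//.
  rewrite (@unif_itv _ (if e then `[2^-1, (u + 1) / 2] else `[0, u / 2])) => //.
  - case: (e) => /=; rewrite !lte_fin -!EFinB -EFinM.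
      case: ltP => h; congr EFin; lra.
    case: ltP => h; congr EFin; lra.
  - exact: mD.
  - apply/seteqP; split => w /=; rewrite /doubling.
      by move=> [[<- ]]; rewrite /digit; case: (leP 2^-1 w) => hw; rewrite !in_itv/=; lra.
    move=> h; have de : digit w = e.
      move: h; rewrite /digit; case: (e) => /=; rewrite in_itv/= => h.
        by apply/idP; lra.
      by apply/negbTE; rewrite -ltNge; lra.
    rewrite de; move: h; case: (e) => /=; rewrite !in_itv/= => h;
      (split; [split; [by []|]|]); lra.
rewrite [in RHS](@unif_itv _ `]0, 0[) => //.
  rewrite (@unif_itv _ `]0, 0[) => //=; first by rewrite ltxx mule0.
    exact: mD.
  apply/seteqP; split => w /=; rewrite /doubling; last by rewrite in_itv/=; lra.
  by move=> [[_ ]]; rewrite /digit; case: (leP 2^-1 w) => hw; rewrite !in_itv/=; lra.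
by apply/seteqP; split => w /=; rewrite !in_itv/=; lra.
Qed.

End uniform.

(** * Independent uniform variables from coin tosses *)

Section rectangles.
Variable X : mspace.

Definition rect (n : nat) (S : nat -> set X) : set (seqs X) :=
  [set x | forall i, (i < n)%N -> S i (x i)].

Definition rects : set (set (seqs X)) :=
  [set C | exists n S, (forall i, measurable (S i)) /\ C = rect n S].

Lemma measurable_rect n S : (forall i, measurable (S i)) ->
  measurable (rect n S).
Proof.
move=> mS; rewrite (_ : rect n S = \bigcap_(i in `I_n)
    ((fun x : seqs X => x i : X) @^-1` S i)) //.
apply: bigcap_measurableType => i _.
by rewrite -[X in measurable X]setTI; exact: measurable_coord.
Qed.

(** Filling up with [setT] allows two cylinders to be compared at the same length. *)
Definition pad (n : nat) (S : nat -> set X) : nat -> set X :=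
  fun i => if (i < n)%N then S i else setT.

Lemma rect_pad n m S : (n <= m)%N -> rect n S = rect m (pad n S).
Proof.
move=> nm; apply/seteqP; split => x h i; rewrite /pad.
  by move=> _; case: ifP => // /h.
by move=> iln; have := h i (leq_trans iln nm); rewrite /pad iln.
Qed.

Lemma measurable_pad n S : (forall i, measurable (S i)) ->
  forall i, measurable (pad n S i).
Proof. by move=> mS i; rewrite /pad; case: ifP. Qed.

Lemma measurable_rects : @measurable _ (seqs X) = <<s rects >>.
Proof.
apply/seteqP; split; last first.
  apply: smallest_sub; first exact: (@sigma_algebra_measurable _ (seqs X)).
  by move=> _ [n [S [mS ->]]]; exact: measurable_rect.
apply: smallest_sub; first exact: smallest_sigma_algebra.
move=> _ [i _ [U mU <-]]; apply: sub_sigma_algebra.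
exists i.+1, (fun j => if j == i then U else setT).
split => [j|]; first by case: ifP.
apply/seteqP; split => x /=; last first.
  by move=> /(_ i (ltnSn i)); rewrite eqxx.
by move=> [_ Ux] j _; case: eqP => // ->.
Qed.

Lemma setI_rects : setI_closed rects.
Proof.
move=> _ _ [n [S [mS ->]]] [m [S' [mS' ->]]].
exists (maxn n m), (fun i => pad n S i `&` pad m S' i); split.
  by move=> i; apply: measurableI; exact: measurable_pad.
rewrite (rect_pad S (leq_maxl n m)) (rect_pad S' (leq_maxr n m)).
apply/seteqP; split => x /=; first by move=> [h h'] i iln; split; [exact: h|exact: h'].
by move=> h; split => i /h [].
Qed.

Lemma rects_setT : rects setT.
Proof. by exists 0%N, (fun=> setT); split => //; apply/seteqP; split. Qed.

Lemma measurable_to_seqs d (T : measurableType d) (f : T -> seqs X) :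
  (forall i, measurable_fun setT (fun t => f t i)) -> measurable_fun setT f.
Proof.
move=> mf.
apply: (@measurability _ _ T (seqs X) setT f (@coord_preimages X)) => //.
move=> _ [_ [i _ [U mU <-]] <-]; rewrite !setTI.
by rewrite -[X in measurable X]setTI; exact: mf.
Qed.

End rectangles.

Section iid_uniform.
Variable R : realType.

Definition mbool : mspace := @MSpace _ bool setT measurableT.

Let Q : probability bool R := law (unif R) (@digit R) (@measurable_digit R).

Let digit_doubling (A : set bool) (B : set R) : measurable A -> measurable B ->
  unif R (@digit R @^-1` A `&` @doubling R @^-1` B) = (Q A * unif R B)%E.
Proof.
have QE e : Q [set e] = (2^-1)%:E.
  have := @doubling_half R e setT (or_intror erefl).
  by rewrite preimage_setT setIT probability_setT mule1.
have mD (e : bool) (C : set R) : measurable C ->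
    measurable (@digit R @^-1` [set e] `&` @doubling R @^-1` C).
  by move=> mC; apply: measurableI; rewrite -[X in measurable X]setTI;
    [exact: measurable_digit|exact: measurable_doubling].
have dT (E : set R) : @digit R @^-1` setT `&` E =
    (@digit R @^-1` [set true] `&` E) `|` (@digit R @^-1` [set false] `&` E).
  apply/seteqP; split => w /=; last by case=> -[_ ?].
  by case=> _ Ew; case: (digit w); [left|right].
move=> mA mB.
apply: (@joint_law_pi R _ _ _ _ _ _ (unif R) _ _ Q (unif R) measurable
  (@rays_setT R)) => //.
- exact: measurable_digit.
- exact: measurable_doubling.
- apply/seteqP; split; first exact: sub_sigma_algebra.
  by apply: smallest_sub => //; exact: sigma_algebra_measurable.
- exact: measurable_rays_setT.
- exact: setI_rays_setT.
- by right.
move=> {mA mB}A {}B _ rB.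
have mB : measurable B by rewrite (measurable_rays_setT R); exact: sub_sigma_algebra.
have [/eqP->|/eqP->|/eqP->|/eqP->] := set_bool A.
- by rewrite doubling_half// QE.
- by rewrite doubling_half// QE.
- by rewrite preimage_set0 set0I !measure0 mul0e.
- rewrite dT measureU//; [|exact: mD|exact: mD|]; last first.
    by apply/seteqP; split => w //= [[-> _] []].
  transitivity ((2^-1)%:E * unif R B + (2^-1)%:E * unif R B)%E.
    by congr (_ + _)%E; exact: doubling_half.
  rewrite probability_setT -ge0_muleDl ?lee_fin//.
  by rewrite -EFinD; congr (_%:E * _)%E; lra.
Qed.

Definition digits (w : R) : seqs mbool := fun i => digit (iter i (@doubling R) w).

Let measurable_digits : measurable_fun setT digits.
Proof.
apply: measurable_to_seqs => i.
apply: (measurableT_comp (@measurable_digit R)).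
elim: i => [|i ih]; first exact: measurable_id.
exact: (measurableT_comp (@measurable_doubling R) ih).
Qed.

Definition coin : probability (seqs mbool) R := law (unif R) digits measurable_digits.

Let coin_rect n (S : nat -> set mbool) :
  coin (rect n S) = (\prod_(i < n) Q (S i))%E.
Proof.
exact: (iter_split_independent (@measurable_digit R) (@measurable_doubling R)
  digit_doubling n (fun i => I)).
Qed.

Definition evens (x : seqs mbool) : seqs mbool := fun i => x i.*2.
Definition odds (x : seqs mbool) : seqs mbool := fun i => x i.*2.+1.

Lemma measurable_evens : measurable_fun setT evens.
Proof. by apply: measurable_to_seqs => i; exact: measurable_coord. Qed.

Lemma measurable_odds : measurable_fun setT odds.
Proof. by apply: measurable_to_seqs => i; exact: measurable_coord. Qed.

Let coin_split_rect n (S S' : nat -> set mbool) :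
  coin (evens @^-1` rect n S `&` odds @^-1` rect n S') =
  (coin (rect n S) * coin (rect n S'))%E.
Proof.
(* The cylinder whose even coordinates are constrained by S and odd ones by S'. *)
pose S2 i := if odd i then S' i./2 else S i./2.
transitivity (coin (rect n.*2 S2)).
  congr (coin _); apply/seteqP; split => x /=.
    move=> [h h'] i; rewrite -{1}(odd_double_half i) /S2.
    case: ifP => oi iln; rewrite -[in x i](odd_double_half i) oi/=.
      by apply: h'; move: iln; rewrite add1n -doubleS leq_double.
    by apply: h; move: iln; rewrite add0n ltn_double.
  move=> h; split => i iln.
    have := h i.*2; rewrite ltn_double => /(_ iln).
    by rewrite /S2 odd_double doubleK.
  have := h i.*2.+1; rewrite -doubleS leq_double => /(_ iln).
  by rewrite /S2 /= odd_double /= uphalf_double.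
rewrite !coin_rect; elim: n => [|n ih]; first by rewrite !big_ord0 mule1.
rewrite doubleS !big_ord_recr/= ih /S2 /= odd_double /= doubleK uphalf_double.
by rewrite -!muleA; congr (_ * _)%E; rewrite muleCA.
Qed.

Lemma coin_split (A B : set (seqs mbool)) : measurable A -> measurable B ->
  coin (evens @^-1` A `&` odds @^-1` B) = (coin A * coin B)%E.
Proof.
move=> mA mB.
apply: (joint_law_pi measurable_evens measurable_odds (@measurable_rects mbool)
  (@setI_rects mbool) (@rects_setT mbool) (@measurable_rects mbool)
  (@setI_rects mbool) (@rects_setT mbool)) => //.
move=> _ _ [n [S [mS ->]]] [m [S' [mS' ->]]].
rewrite (rect_pad S (leq_maxl n m)) (rect_pad S' (leq_maxr n m)).
exact: coin_split_rect.
Qed.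

Definition binary_sum (x : seqs mbool) (n : nat) : R :=
  \sum_(i < n) (x i)%:R / 2 ^+ i.+1.

Definition binary_value (x : seqs mbool) : R := limn (binary_sum x).

Lemma is_cvg_binary_value (x : seqs mbool) :
  cvgn (binary_sum x).
Proof.
apply: nondecreasing_is_cvgn.
  apply/nondecreasing_seqP => n; rewrite /binary_sum big_ord_recr/=.
  by rewrite lerDl divr_ge0 ?ler0n.
exists 1 => _ [n _ <-]; rewrite /binary_sum.
suff : \sum_(i < n) (x i)%:R / 2 ^+ i.+1 + 2^-1 ^+ n <= 1 :> R.
  by apply: le_trans; rewrite lerDl exprn_ge0.
elim: n => [|n ih]; first by rewrite big_ord0 add0r.
rewrite big_ord_recr/= (le_trans _ ih)// -addrA lerD2l.
rewrite -exprVn !exprS; have : 0 <= (2^-1 : R) ^+ n by exact: exprn_ge0.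
by case: (x n) => /=; nra.
Qed.

Lemma measurable_binary_value : measurable_fun setT binary_value.
Proof.
apply: (@measurable_fun_cvg _ _ R setT
(fun n x => binary_sum x n)).
  move=> n; apply: measurable_sum => i.
  apply: measurable_funM => //.
  rewrite (_ : (fun _ => _) = (fun b : bool => b%:R : R) \o
    (fun x : seqs mbool => x i : mbool)) //.
  apply: measurableT_comp => //; exact: (@measurable_coord mbool i).
by move=> x _; exact: is_cvg_binary_value.
Qed.

(** After n digits the error is the n-th iterate of the doubling map divided by
    2^n. *)
Lemma binary_value_digits w : 0 <= w < 1 -> binary_value (digits w) = w.
Proof.
move=> w01; rewrite /binary_value.
have tw i : 0 <= iter i (@doubling R) w < 1.
  elim: i => [//|i] /=; set v := iter _ _ _ => ih.
  by rewrite /doubling /digit; case: (leP 2^-1 v) => hv /=; lra.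
have E n : binary_sum (digits w) n =
    w - iter n (@doubling R) w * 2^-1 ^+ n.
  elim: n => [|n ih]; first by rewrite /binary_sum big_ord0 expr0 mulr1 subrr.
  rewrite /binary_sum big_ord_recr/= -/(binary_sum _ _) ih.
  by rewrite /digits /doubling -exprVn !exprS; field.

apply: cvg_lim; first exact: Rhausdorff.
rewrite (funext E).
rewrite -[X in _ --> X]subr0; apply: cvgB; first exact: cvg_cst.
apply/norm_cvg0P; apply: (@squeeze_cvgr _ _ _ _ (fun=> 0) (fun n => 2^-1 ^+ n)).
- near=> n; have /andP[h0 h1] := tw n.
  have e0 : 0 <= (2^-1 : R) ^+ n by rewrite exprn_ge0// invr_ge0.
  by rewrite normr_ge0/= ger0_norm ?mulr_ge0// ler_piMl// ltW.
- exact: cvg_cst.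
- by apply: cvg_expr; rewrite gtr0_norm; lra.
Unshelve. all: by end_near. Qed.

(** Reading the digits of a uniform variable back recovers the variable. *)
Lemma coin_binary_value (A : set R) : measurable A ->
  coin (binary_value @^-1` A) = unif R A.
Proof.
move=> mA; rewrite /coin lawE.
have m01 : measurable (`]0, 1[%classic : set R) by exact: measurable_itv.
have mB : measurable ((binary_value \o digits) @^-1` A).
  rewrite -[X in measurable X]setTI.
  exact: (measurableT_comp measurable_binary_value measurable_digits).
rewrite -(prob1_setI mB m01 (unif_itv01 R)) -[RHS](prob1_setI mA m01 (unif_itv01 R)).
congr (unif R _).
apply/seteqP; split => w /= [+ w01]; (split => //);
  move: (w01); rewrite in_itv/= => /andP[w0 w1].
  by move: a; rewrite binary_value_digits ?ltW.
by rewrite binary_value_digits ?ltW.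
Qed.

(** The variable with index i is read off the even part of the i-th iterated odd
    part of a single sequence of coins. *)
Lemma ex_iid_uniform : exists W : nat -> seqs mbool -> R,
  (forall i, measurable_fun setT (W i)) /\
  forall n (S : nat -> set R), (forall i, measurable (S i)) ->
    coin [set w | forall i, (i < n)%N -> S i (W i w)] =
    (\prod_(i < n) unif R (S i))%E.
Proof.
have mh := measurableT_comp measurable_binary_value measurable_evens.
exists (fun i w => (binary_value \o evens) (iter i odds w)); split.
  move=> i; apply: (measurableT_comp mh).
  elim: i => [|i ih]; first exact: measurable_id.
  exact: (measurableT_comp measurable_odds ih).
apply: (iter_split_independent mh measurable_odds) => A B mA mB.
rewrite -[X in X `&` _]/(evens @^-1` (binary_value @^-1` A)).
rewrite coin_split ?coin_binary_value//.
by rewrite -[X in measurable X]setTI; exact: measurable_binary_value.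
Qed.
End iid_uniform.

(** * Quantile functions and infinite product measures *)

Section quantile.
Variable R : realType.

(** Limits are stated by explicit bounds because they will be read off finite
    samples. *)
Record is_cdf (F : R -> R) : Prop := IsCdf {
  cdf01 : forall t, 0 <= F t <= 1;
  cdf_nd : forall s t, s <= t -> F s <= F t;
  cdf_rc : forall t e, 0 < e -> exists2 s, t < s & F s < F t + e;
  cdf_top : forall e, 0 < e -> exists t, 1 - e < F t;
  cdf_bot : forall e, 0 < e -> exists t, F t < e }.

(** The value outside the open unit interval is arbitrary: it only matters on
    a null set of the uniform distribution. *)
Definition quantile (F : R -> R) (u : R) : R :=
  if 0 < u < 1 then inf [set t | u <= F t] else 0.

(** The Galois connection between a distribution function and its quantile
    function; right-continuity is what makes the infimum attained. *)
Lemma quantile_le F u t : is_cdf F -> 0 < u < 1 ->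
  (quantile F u <= t) = (u <= F t).
Proof.
move=> cF u01; rewrite /quantile u01; case/andP: u01 => u0 u1.
have lbE s : F s < u -> lbound [set t | u <= F t] s.
  move=> Fs r /= ur; rewrite leNgt; apply/negP => rs.
  by have := cdf_nd cF (ltW rs); rewrite leNgt (lt_le_trans Fs).
have [b /lbE hb] := cdf_bot cF u0.
have u1' : 0 < 1 - u by rewrite subr_gt0.
have [a ha] := cdf_top cF u1'.
have ne : [set t | u <= F t] !=set0 by exists a; rewrite /= ltW//; lra.
apply/idP/idP => [|h]; last by apply: ge_inf => //; exists b.
apply: contraTT; rewrite -!ltNge => Ftu.
have uF : 0 < u - F t by rewrite subr_gt0.
have [s ts Fs] := cdf_rc cF t uF.
by rewrite (lt_le_trans ts)//; apply: lb_le_inf => //; apply: lbE; lra.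
Qed.

Lemma measurable_quantile F : is_cdf F -> measurable_fun setT (quantile F).
Proof.
move=> cF; apply: (@measurability _ _ R R setT (quantile F) (@rays R)).
  exact: measurable_rays.
have m01 : measurable (`]0, 1[%classic : set R) by exact: measurable_itv.
move=> _ [_ [t ->] <-]; rewrite setTI.
rewrite (_ : _ @^-1` _ = (`]0, 1[ `&` `]-oo, F t]) `|` 
    (~` `]0, 1[ `&` (if 0 <= t then setT else set0))).
  apply: measurableU; apply: measurableI => //; last by case: ifP.
  exact: measurableC.
apply/seteqP; split => u /=; rewrite !in_itv/=.
  have [u01|u01] := boolP (0 < u < 1); first by rewrite quantile_le//; left.
  by rewrite /quantile (negbTE u01) => t0; right; rewrite t0; split=> //; apply/negP.
by case=> [[u01 uF]|[/negP/negbTE u01]]; [rewrite quantile_le|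
  rewrite /quantile u01; case: ifP].
Qed.

Definition cdf_law F (cF : is_cdf F) : probability R R :=
  law (unif R) (quantile F) (measurable_quantile cF).

(** By the Galois connection, the quantile of u is at most t exactly when u is at
    most F t, which has probability F t. *)
Lemma cdf_lawE F (cF : is_cdf F) t : cdf_law cF `]-oo, t]%classic = (F t)%:E.
Proof.
have m01 : measurable (`]0, 1[%classic : set R) by exact: measurable_itv.
have mr : measurable (`]-oo, t]%classic : set R) by exact: measurable_itv.
rewrite -(unif_ray (cdf01 cF t)) lawE.
rewrite -(prob1_setI _ m01 (unif_itv01 R)); last first.
  by rewrite -[X in measurable X]setTI; exact: measurable_quantile.
rewrite -[RHS](prob1_setI _ m01 (unif_itv01 R)); last exact: measurable_itv.
congr (unif R _); apply/seteqP; split => u /=; rewrite !in_itv/= => -[+ u01].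
  by rewrite quantile_le.
by rewrite quantile_le.
Qed.

Lemma eq_probability_rays (mu nu : probability R R) :
  (forall t, mu `]-oo, t]%classic = nu `]-oo, t]%classic) ->
  forall A, measurable A -> mu A = nu A.
Proof.
move=> h; apply: (eq_measure_pi (measurable_rays R) (@setI_rays R)).
- by transitivity (1%E : \bar R); [|apply: esym]; exact: probability_setT.
- by apply: (@le_lt_trans _ _ (1%E : \bar R)); [exact: probability_le1|exact: ltry].
- by move=> A [t ->]; exact: h.
Qed.

Section cdf_of_probability.
Variable mu : probability R R.

Let idR : R -> R := idfun.

#[local] HB.instance Definition _ :=
  @isMeasurableFun.Build _ _ R R idR (@measurable_id _ R setT).

Lemma is_cdf_probability : is_cdf (fun t => fine (mu `]-oo, t]%classic)).
Proof.
have muE t : (fine (mu `]-oo, t]%classic))%:E = cdf (idR : {RV mu >-> R}) t.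
  by rewrite fineK// fin_num_measure.
split.
- move=> t; rewrite -!lee_fin muE cdf_ge0 cdf_le1//.
- by move=> s t st; rewrite -lee_fin !muE; exact: cdf_nondecreasing.
- move=> t e e0.
  have /(_ t) : right_continuous (cdf (idR : {RV mu >-> R})).
    exact: cdf_right_continuous.
  rewrite -muE => /fine_cvgP[_].
  move=> /cvgrPdist_lt /(_ _ e0).
  move=> [r /= r0 /(_ (t + r / 2))] /=.
  rewrite opprD addrA subrr sub0r normrN gtr0_norm ?divr_gt0//.
  rewrite ltr_pdivrMr// ltr_pMr// ltr1n ltrDl divr_gt0// => /(_ erefl erefl).
  rewrite distrC => h.
  exists (t + r / 2); first by rewrite ltrDl divr_gt0.
  by have := ltr_distlDr h; rewrite addrC.
- move=> e e0; have : cdf (idR : {RV mu >-> R}) @ +oo --> 1%E by exact: cvg_cdfy1.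
  move=> /fine_cvgP[_] /cvgrPdist_lt /(_ _ e0) [M [_ /(_ (M + 1))]].
  rewrite /= ltrDl => /(_ ltr01) h; exists (M + 1).
  by have := ltr_distlBl h; lra.
- move=> e e0; have : cdf (idR : {RV mu >-> R}) @ -oo --> 0%E by exact: cvg_cdfNy0.
  move=> /fine_cvgP[_] /cvgrPdist_lt /(_ _ e0) [M [_ /(_ (M - 1))]].
  rewrite /= ltrBlDr ltrDl => /(_ ltr01) h; exists (M - 1).
  by move: h; rewrite sub0r normrN => /(le_lt_trans (ler_norm _)).
Qed.

End cdf_of_probability.

(** Apply the quantile function of [mu] to independent uniform variables. *)
Lemma ex_iprod (mu : probability R R) :
  exists nu : probability (mpow (mreal R)) R, is_iprod (X := mreal R) mu nu.
Proof.
have [W [mW hW]] := ex_iid_uniform R.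
have cF := is_cdf_probability mu; set F := (fun t => _) in cF.
have muE (A : set R) : measurable A -> mu A = cdf_law cF A.
  apply: eq_probability_rays => t; rewrite cdf_lawE /F fineK//.
  by rewrite fin_num_measure//; exact: measurable_itv.
pose q (w : seqs mbool) : seqs (mreal R) := fun i => quantile F (W i w).
have mQ : measurable_fun setT q.
  apply: measurable_to_seqs => i.
  exact: (measurableT_comp (measurable_quantile cF) (mW i)).
exists (law (coin R) _ mQ) => n S mS; rewrite lawE.
under eq_bigr do rewrite muE// /cdf_law lawE.
apply: (hW n (fun i => quantile F @^-1` S i)) => i; rewrite -[X in measurable X]setTI.
exact: (measurable_quantile cF).
Qed.

End quantile.

(** * Empirical distribution functions *)

Section frequencies.
Variable R : realType.
Implicit Types (x y : nat -> R) (T : set R) (n m : nat) (t e : R).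

Lemma relfreqE x T n :
  relfreq x T n = (\sum_(i < n) (x i \in T)%:R) / n%:R.
Proof.
rewrite /relfreq; congr (_ / _).
rewrite -sum1_card natr_sum big_mkcond; apply: eq_bigr => i _; by rewrite inE; case: ifP.
Qed.

Lemma eq_relfreq x y T T' n :
  (forall i, (i < n)%N -> (T (x i) <-> T' (y i))) ->
  relfreq x T n = relfreq y T' n.
Proof.
move=> h; rewrite !relfreqE; congr (_ / _); apply: eq_bigr => i _.
suff -> : (x i \in T) = (y i \in T') by [].
by apply/idP/idP => /set_mem xT; apply/mem_set; apply/(h _ (ltn_ord i)).
Qed.

Lemma le_relfreq x T T' n : T `<=` T' -> relfreq x T n <= relfreq x T' n.
Proof.
move=> TT'; rewrite !relfreqE ler_wpM2r// ?invr_ge0// ler_sum// => i _.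
by rewrite ler_nat; case: (boolP (x i \in T)) => // /set_mem/TT'/mem_set ->.
Qed.

Lemma relfreq_set0 x n : relfreq x set0 n = 0.
Proof.
by rewrite relfreqE big1 ?mul0r// => i _; rewrite in_set0.
Qed.

Lemma relfreq_setT x n : (0 < n)%N -> relfreq x setT n = 1.
Proof.
move=> n0; rewrite relfreqE (eq_bigr (fun=> 1)) => [|i _]; last by rewrite in_setT.
by rewrite sumr_const card_ord divff// pnatr_eq0 -lt0n.
Qed.

Lemma relfreq_ge0 x T n : 0 <= relfreq x T n.
Proof. by rewrite -(relfreq_set0 x n); exact: le_relfreq. Qed.

Lemma relfreq_le1 x T n : relfreq x T n <= 1.
Proof.
case: n => [|n]; first by rewrite relfreqE big_ord0 mul0r.
by rewrite -(relfreq_setT x (ltn0Sn n)); exact: le_relfreq.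
Qed.

Lemma relfreqU x T T' n : T `&` T' = set0 ->
  relfreq x (T `|` T') n = relfreq x T n + relfreq x T' n.
Proof.
move=> TT'; rewrite !relfreqE -mulrDl -big_split/=; congr (_ / _).
apply: eq_bigr => i _; rewrite in_setU.
case: (boolP (x i \in T)) => [Tx|_]; last by rewrite add0r.
case: (boolP (x i \in T')) => [T'x|_]; last by rewrite addr0.
suff : (T `&` T') (x i) by rewrite TT'.
by split; exact: set_mem.
Qed.

Definition ecdf x n t : R := relfreq x `]-oo, t]%classic n.

Lemma ecdf_nd x n s t : s <= t -> ecdf x n s <= ecdf x n t.
Proof.
by move=> st; apply: le_relfreq => u /=; rewrite !in_itv/= => /le_trans; exact.
Qed.

(** Finitely many observations leave a gap to the right of any threshold. *)
Lemma ecdf_right x N t : exists2 s, t < s & forall r n, t <= r <= s ->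
  (n <= N)%N -> ecdf x n r = ecdf x n t.
Proof.
suff [s ts hs] : exists2 s, t < s & forall i, (i < N)%N -> t < x i -> s < x i.
  exists s => // r n /andP[tr rs] nN; apply: eq_relfreq => i iln /=.
  rewrite !in_itv/=; split; last by move=> /le_trans; exact.
  move=> xr; rewrite leNgt; apply/negP => /(hs _ (leq_trans iln nN)).
  by rewrite ltNge (le_trans xr).
elim: N => [|N [s ts hs]]; first by exists (t + 1); rewrite // ltrDl.
have [txN|xNt] := ltP t (x N); last first.
  exists s => // i; rewrite ltnS leq_eqVlt => /orP[/eqP ->|]; last exact: hs.
  by rewrite ltNge xNt.
exists (Num.min s ((t + x N) / 2)).
  by rewrite lt_min ts/=; lra.
move=> i; rewrite ltnS leq_eqVlt => /orP[/eqP -> _|iN /(hs _ iN) sx].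
  by rewrite gt_min; apply/orP; right; lra.
by rewrite gt_min sx.
Qed.

(** No observation of a finite sample lies in a short enough interval that ends at t
    and excludes t. *)
Lemma ecdf_left x N t : exists2 s, s < t & forall r n, s <= r < t ->
  (n <= N)%N -> ecdf x n r = relfreq x `]-oo, t[%classic n.
Proof.
suff [s st hs] : exists2 s, s < t & forall i, (i < N)%N -> x i < t -> x i < s.
  exists s => // r n /andP[sr rt] nN; apply: eq_relfreq => i iln /=.
  rewrite !in_itv/=; split; first by move=> /le_lt_trans; exact.
  by move=> /(hs _ (leq_trans iln nN)) /ltW/le_trans; exact.
elim: N => [|N [s st hs]]; first by exists (t - 1); rewrite // gtrDl ltrN10.
have [txN|xNt] := ltP (x N) t; last first.
  exists s => // i; rewrite ltnS leq_eqVlt => /orP[/eqP ->|]; last exact: hs.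
  by rewrite ltNge xNt.
exists (Num.max s ((t + x N) / 2)).
  by rewrite gt_max st/=; lra.
move=> i; rewrite ltnS leq_eqVlt => /orP[/eqP -> _|iN /(hs _ iN) sx].
  by rewrite lt_max; apply/orP; right; lra.
by rewrite lt_max sx.
Qed.

Lemma ecdf_eq1 x n : (0 < n)%N -> exists t, ecdf x n t = 1.
Proof.
move=> n0; suff [t ht] : exists t, forall i, (i < n)%N -> x i <= t.
  exists t; rewrite -(relfreq_setT x n0); apply: eq_relfreq => i /ht xt.
  by split => //= _; rewrite in_itv.
elim: (n) => [|k [t ht]]; first by exists 0.
exists (Num.max t (x k)) => i; rewrite ltnS leq_eqVlt => /orP[/eqP ->|/ht xt].
  by rewrite le_max lexx orbT.
by rewrite le_max xt.
Qed.

Lemma ecdf_eq0 x n : exists t, ecdf x n t = 0.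
Proof.
suff [t ht] : exists t, forall i, (i < n)%N -> t < x i.
  exists t; rewrite -(relfreq_set0 x n); apply: eq_relfreq => i /ht xt.
  by split => //=; rewrite in_itv/= leNgt xt.
elim: (n) => [|k [t ht]]; first by exists 0.
exists (Num.min t (x k - 1)) => i; rewrite ltnS leq_eqVlt => /orP[/eqP ->|/ht xt].
  by rewrite gt_min gtrDl ltrN10 orbT.
by rewrite gt_min xt.
Qed.

Lemma uniform_cvgP (u : nat -> rat -> R) (F : rat -> R) :
  {uniform, u @ \oo --> F} <->
  forall e : R, 0 < e -> exists N, forall n q, (N <= n)%N -> `|F q - u n q| < e.
Proof.
split=> [uF e e0|h P].
  have /uF [N _ hN] : nbhs (F : {uniform rat -> R})
      [set h : rat -> R | forall q, `|F q - h q| < e].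
    apply/uniform_nbhs; exists [set xy | `|xy.1 - xy.2| < e]; split.
      by rewrite -entourage_ballE; exists e.
    by move=> h /= + q; exact.
  by exists N => n q Nn; exact: (hN n Nn).
move=> /uniform_nbhs[E [+ EP]]; rewrite -entourage_ballE => -[e e0 eE].
have [N hN] := h e e0.
by exists N => // n /= Nn; apply: EP => q _; apply: eE; exact: hN.
Qed.

Definition ecdf_cauchy x := forall e : R, 0 < e -> exists N, forall n m t,
  (N <= n)%N -> (N <= m)%N -> `|ecdf x n t - ecdf x m t| <= e.

(** Through such rational thresholds, uniformity over the rationals becomes
    uniformity over the reals. *)
Lemma ecdf_rat x N t : exists q : rat, forall n, (n <= N)%N ->
  ecdf x n t = ecdf x n (ratr q).
Proof.
have [s ts hs] := ecdf_right x N t.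
have [q] := rat_in_itvoo ts; rewrite in_itv/= => /andP[tq qs].
by exists q => n nN; rewrite hs// !ltW.
Qed.

Lemma is_cvg_ecdf x t : ecdf_cauchy x -> cvgn (ecdf x ^~ t).
Proof.
move=> cx; apply/cauchy_cvgP; apply/cauchy_exP => e e0.
have [N hN] := cx (e / 2) (divr_gt0 e0 (ltr0Sn R 1)).
exists (ecdf x N t); exists N => // n /= Nn; rewrite /ball/=.
by apply: (le_lt_trans (hN _ _ _ _ _)) => //; lra.
Qed.

Lemma ecdf_lim_dist x e N n t : ecdf_cauchy x ->
  (forall n m t, (N <= n)%N -> (N <= m)%N -> `|ecdf x n t - ecdf x m t| <= e) ->
  (N <= n)%N -> `|limn (ecdf x ^~ t) - ecdf x n t| <= e.
Proof.
move=> cx hN Nn; have cvx := is_cvg_ecdf (t := t) cx.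
have cvd : `|ecdf x m t - ecdf x n t| @[m --> \oo] -->
    `|limn (ecdf x ^~ t) - ecdf x n t|.
  by apply: cvg_norm; apply: cvgB => //; exact: cvg_cst.
rewrite -(cvg_lim _ cvd)//; apply: limr_le; first by apply/cvg_ex; eexists; exact: cvd.
by exists N => // m /= Nm; exact: hN.
Qed.

(** The Cauchy form quantifies over all real thresholds and mentions no limit,
    which makes it easy both to test for measurability and to verify. *)
Lemma esR_dom_cauchy x : @esR_dom R x <-> ecdf_cauchy x.
Proof.
split=> [[F /uniform_cvgP FE] e e0|cx].
  have [N hN] := FE (e / 2) (divr_gt0 e0 (ltr0Sn R 1)).
  exists N => n m t Nn Nm.
  have [q hq] := ecdf_rat x (maxn n m) t.
  rewrite !hq ?leq_maxl ?leq_maxr//.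
  apply: (le_trans (ler_distD (F q) _ _)); rewrite [e]splitr ltW//.
  by apply: ltrD; [rewrite distrC|]; exact: hN.
exists (fun q => limn (ecdf x ^~ (ratr q))); apply/uniform_cvgP => e e0.
have [N hN] := cx (e / 2) (divr_gt0 e0 (ltr0Sn R 1)).
exists N => n q Nn; apply: (@le_lt_trans _ _ (e / 2)); last by lra.
exact: (ecdf_lim_dist _ cx hN Nn).
Qed.

End frequencies.

(** * The empirical law of a sequence *)

Section empirical_law.
Variable R : realType.
Implicit Types (x y : nat -> R) (T : set R) (n m : nat) (t e : R).

(** Each property holds exactly for a single empirical distribution function that
    is uniformly close to the limit, and so approximately for the limit. *)
Lemma is_cdf_lim x : ecdf_cauchy x -> is_cdf (fun t => limn (ecdf x ^~ t)).
Proof.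
move=> cx; set G := fun t => _.
have cvG t : ecdf x n t @[n --> \oo] --> G t by exact: is_cvg_ecdf.
have close (e : R) : 0 < e -> exists2 n, (0 < n)%N & forall t, `|G t - ecdf x n t| <= e.
  move=> e0; have [N hN] := cx _ e0; exists N.+1 => // t.
  exact: (ecdf_lim_dist t cx hN (leqnSn N)).
have e3 (e : R) : 0 < e -> 0 < e / 3 :> R by move=> e0; rewrite divr_gt0.
split.
- move=> t; apply/andP; split.
    apply: limr_ge; first exact: is_cvg_ecdf.
    by apply: nearW => n; exact: relfreq_ge0.
  apply: limr_le; first exact: is_cvg_ecdf.
  by apply: nearW => n; exact: relfreq_le1.
- move=> s t st; apply: ler_lim; [exact: is_cvg_ecdf|exact: is_cvg_ecdf|].
  by apply: nearW => n; exact: ecdf_nd.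
- move=> t e e0; have [n _ hn] := close _ (e3 _ e0).
  have [s ts hs] := ecdf_right x n t.
  have hst : ecdf x n s = ecdf x n t by apply: hs => //; rewrite lexx ltW.
  exists s => //; have := hn s; have := hn t; rewrite hst.
  rewrite !ler_distl => /andP[? ?] /andP[? ?]; lra.
- move=> e e0; have [n n0 hn] := close _ (e3 _ e0).
  have [t ht] := ecdf_eq1 x n0; exists t; have := hn t.
  rewrite ht ler_distl => /andP[? ?]; lra.
- move=> e e0; have [n n0 hn] := close _ (e3 _ e0).
  have [t ht] := ecdf_eq0 x n; exists t; have := hn t.
  rewrite ht ler_distl => /andP[? ?]; lra.
Qed.

Definition lower_ray (b : itv_bound R) : set R := [set` Interval -oo%O b].

Lemma lower_rayU (a b : itv_bound R) : (a <= b)%O ->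
  lower_ray b = lower_ray a `|` [set` Interval a b].
Proof. by move=> ab; rewrite -itv_bndbnd_setU. Qed.

Lemma lower_rayI (a b : itv_bound R) :
  lower_ray a `&` [set` Interval a b] = set0.
Proof.
apply/seteqP; split => // u /= [].
by rewrite !itv_boundlr => /andP[_ ua] /andP[/(le_trans ua)]; rewrite bnd_simp ltxx.
Qed.

(** An interval is the difference of two lower rays. *)
Lemma relfreq_cvg_interval x (mu : probability R R) :
  (forall b : itv_bound R,
    relfreq x (lower_ray b) n @[n --> \oo] --> fine (mu (lower_ray b))) ->
  esR_measure x mu.
Proof.
move=> h T /is_intervalP ->; case: (Rhull T) => a b.
have mI (c d : itv_bound R) : measurable ([set` Interval c d] : set R).
  exact: measurable_itv.
have [ab|ba] := leP a b; last first.
  rewrite set_itv_ge; last by rewrite -leNgt ltW.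
  rewrite measure0; under eq_fun do rewrite relfreq_set0; exact: cvg_cst.
rewrite -[mu _]fineK ?fin_num_measure//; apply: cvg_EFin; first exact: nearW.
have -> : fine (mu [set` Interval a b]) =
    fine (mu (lower_ray b)) - fine (mu (lower_ray a)).
  rewrite (lower_rayU ab) (measureU _ (mI _ _) (mI _ _) (lower_rayI _ _)).
  by rewrite fineD ?fin_num_measure// addrC addKr.
rewrite (_ : _ \o _ = (fun n => relfreq x (lower_ray b) n - relfreq x (lower_ray a) n)).
  by apply: cvgB; exact: h.
apply/funext => n /=; rewrite (lower_rayU ab) relfreqU; last exact: lower_rayI.
by rewrite addrC addKr.
Qed.

(** The delicate case is an open ray, which needs the convergence of left limits.
    The distance between the two values at t- is the limit of distances at points
    increasing to t, and those are bounded uniformly. *)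
Lemma ex_esR_measure x : ecdf_cauchy x ->
  exists mu : probability R R, esR_measure x mu.
Proof.
move=> cx; pose G t := limn (ecdf x ^~ t).
have cF : is_cdf G by exact: is_cdf_lim.
exists (cdf_law cF); set mu := cdf_law cF.
have muE t : mu `]-oo, t]%classic = (G t)%:E by rewrite /mu cdf_lawE.
have cvG t : ecdf x n t @[n --> \oo] --> G t by exact: is_cvg_ecdf.
apply: relfreq_cvg_interval => -[[] t|[]]; rewrite /lower_ray.
- apply/cvgrPdist_le => e e0.
  (* The bound e at the thresholds t - 1/(k+1) is carried to t- by letting k grow. *)
  have [N hN] := cx _ e0; exists N => // n /= Nn.
  have [s0 s0t hs0] := ecdf_left x n t.
  have cvo : fine (mu `]-oo, (t - k.+1%:R^-1)]%classic) @[k --> \oo] -->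
      fine (mu `]-oo, t[%classic).
    apply: fine_cvg; rewrite fineK ?fin_num_measure//.
    rewrite (_ : `]-oo, t[%classic = \bigcup_k `]-oo, (t - k.+1%:R^-1)]%classic).
      apply: nondecreasing_cvg_mu => //.
        by apply: bigcup_measurable => k _; exact: measurable_itv.
      move=> k l kl; apply/subsetPset; apply: subset_itvl.
      by rewrite bnd_simp lerD2l lerN2 lef_pV2 ?posrE// ler_nat.
    apply/seteqP; split => u /=; rewrite in_itv/=.
      by move=> /ltr_add_invr[k uk]; exists k => //=; rewrite in_itv/= lerBrDr ltW.
    move=> [k _]; rewrite /= in_itv/= => /le_lt_trans; apply.
    by rewrite gtrDl oppr_lt0 invr_gt0.
  have cvd : `|fine (mu `]-oo, (t - k.+1%:R^-1)]%classic) -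
      relfreq x `]-oo, t[%classic n| @[k --> \oo] -->
      `|fine (mu `]-oo, t[%classic) - relfreq x `]-oo, t[%classic n|.
    by apply: cvg_norm; apply: cvgB => //; exact: cvg_cst.
  rewrite -(cvg_lim _ cvd)//; apply: limr_le.
    by apply/cvg_ex; eexists; exact: cvd.
  have [K hK] := ltr_add_invr s0t.
  exists K => // k /= Kk.
  rewrite (_ : fine _ = G (t - k.+1%:R^-1)); last exact: (congr1 fine (muE _)).
  rewrite -(hs0 (t - k.+1%:R^-1) n)//; last first.
    rewrite gtrDl oppr_lt0 invr_gt0 ltr0Sn andbT.
    rewrite lerBrDr (le_trans _ (ltW hK))// lerD2l lef_pV2 ?posrE// ler_nat.
    exact: Kk.
  exact: (ecdf_lim_dist _ cx hN Nn).
- by rewrite muE /=; exact: cvG.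
- rewrite set_itvE measure0; under eq_fun do rewrite relfreq_set0; exact: cvg_cst.
- rewrite set_itvE probability_setT /=.
  apply: cvg_near_cst; exists 1%N => // n /= n0; exact: relfreq_setT.
Qed.

Lemma esR_measure_unique x (mu nu : probability R R) :
  esR_measure x mu -> esR_measure x nu ->
  forall A, measurable A -> nu A = mu A.
Proof.
move=> hmu hnu; apply: eq_probability_rays => t.
have iT : is_interval (`]-oo, t]%classic : set R) by exact: interval_is_interval.
exact: (cvg_unique _ (hnu _ iT) (hmu _ iT)).
Qed.

Lemma finite_perm_bound s : finite_perm s ->
  exists N, forall i, (N <= i)%N -> s i = i.
Proof.
move=> [_ /finite_seqP[l hl]]; exists (\max_(i <- l) i).+1 => i Ni.
apply: contrapT => sii.
have il : i \in l by have : [set i | s i <> i] i by []; rewrite hl.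
by move: Ni; rewrite ltnNge (@leq_bigmax_seq _ l predT id i il isT).
Qed.

(** Beyond the support, a finite permutation only rearranges the first n terms. *)
Lemma relfreq_perm x s : finite_perm s ->
  exists N, forall n T, (N <= n)%N -> relfreq (x \o s) T n = relfreq x T n.
Proof.
move=> fs; have [N hN] := finite_perm_bound fs; exists N => n T Nn.
have sinj : injective s by case: fs => /bij_inj.
have sn (i : 'I_n) : (s i < n)%N.
  rewrite ltnNge; apply/negP => nsi.
  have := hN _ (leq_trans Nn nsi) => /sinj si.
  by move: nsi; rewrite si leqNgt ltn_ord.
pose h (i : 'I_n) : 'I_n := Ordinal (sn i).
have hinj : injective h.
  by move=> i j /(congr1 val)/= /sinj ij; exact: val_inj.
by rewrite !relfreqE [in RHS](reindex_inj hinj).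
Qed.

Lemma ecdf_cauchy_perm x s : finite_perm s ->
  ecdf_cauchy (x \o s) <-> ecdf_cauchy x.
Proof.
move=> fs; have [M hM] := relfreq_perm x fs.
have E n t : (M <= n)%N -> ecdf (x \o s) n t = ecdf x n t by exact: hM.
by split=> cx e /cx[N hN]; exists (maxn M N) => n m t;
  rewrite !geq_max => /andP[Mn Nn] /andP[Mm Nm];
  have := hN n m t Nn Nm; rewrite !E.
Qed.

Lemma esR_measure_perm x s (mu : probability R R) : finite_perm s ->
  esR_measure x mu -> esR_measure (x \o s) mu.
Proof.
move=> fs h T iT; have [M hM] := relfreq_perm x fs.
apply: cvg_trans (h T iT); apply: near_eq_cvg; exists M => // n /= Mn.
by rewrite hM.
Qed.

(** The value outside the domain is the same for all sequences, so that the
    invariance under permutations and the measurability hold everywhere. *)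
Definition empirical_law x : probability R R :=
  if pselect (ecdf_cauchy x) is left cx then sval (cid (ex_esR_measure cx))
  else dirac (0 : R).

Lemma empirical_lawP x : ecdf_cauchy x -> esR_measure x (empirical_law x).
Proof.
rewrite /empirical_law; case: pselect => // cx _.
exact: (svalP (cid (ex_esR_measure cx))).
Qed.

Lemma empirical_law_perm x s A : finite_perm s -> measurable A ->
  empirical_law (x \o s) A = empirical_law x A.
Proof.
move=> fs mA; have [cx|ncx] := pselect (ecdf_cauchy x).
  apply: (@esR_measure_unique (x \o s)) => //.
    by apply: esR_measure_perm => //; exact: empirical_lawP.
  by apply: empirical_lawP; apply/(ecdf_cauchy_perm _ fs).
rewrite /empirical_law; case: pselect => [/(ecdf_cauchy_perm _ fs)//|_].
by case: pselect.
Qed.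

End empirical_law.

(** * The empirical sampling kernel and its infinite power *)

Section kernels.
Variable R : realType.
Local Open Scope ereal_scope.

(** The sets whose mass is a measurable function of the parameter form a
    lambda-system. *)
Lemma measurable_kernel_pi d1 d2 (T1 : measurableType d1)
    (T2 : measurableType d2) (D : set T1) (k : T1 -> probability T2 R)
    (G : set (set T2)) :
  measurable D -> @measurable _ T2 = <<s G >> -> setI_closed G ->
  (forall A, G A -> measurable_fun D (k ^~ A)) ->
  forall A, measurable A -> measurable_fun D (k ^~ A).
Proof.
move=> mD mE GI mG A mA.
pose H := [set B : set T2 | measurable B /\ measurable_fun D (k ^~ B)].
suff : <<s G >> `<=` H by move=> h; move: mA; rewrite {1}mE => /h[].
apply: lambda_system_subset => //; last first.
  by move=> B GB; split; [rewrite mE; exact: sub_sigma_algebra|exact: mG].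
split => //.
- split => //; apply: (eq_measurable_fun (cst 1)) => //.
  by move=> x _; rewrite probability_setT.
- move=> B C CB [mB mkB] [mC mkC]; split; first exact: measurableD.
  apply: (eq_measurable_fun (fun x => k x B - k x C)); last exact: emeasurable_funB.
  move=> x _; rewrite measureD//; first by rewrite setIidr.
  by rewrite (le_lt_trans (probability_le1 _ _))// ltry.
- move=> F ndF mF; have mU : measurable (\bigcup_n F n).
    by apply: bigcup_measurable => n _; have [] := mF n.
  split => //; apply: (emeasurable_fun_cvg (fun n x => k x (F n))).
    by move=> n; have [] := mF n.
  move=> x _; apply: nondecreasing_cvg_mu => // n.
  by have [] := mF n.
Qed.

Local Open Scope ring_scope.

Lemma measurable_relfreq (T : set R) n : measurable T ->
  measurable_fun setT (fun x : seqs (mreal R) => relfreq x T n).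
Proof.
move=> mT; rewrite (_ : (fun _ => _) = (fun x : seqs (mreal R) =>
    (\sum_(i < n) (\1_T (x i : R) : R)) / n%:R)); last first.
  by apply/funext => x; rewrite relfreqE.
apply: measurable_funM => //; apply: measurable_sum => i.
apply: (measurableT_comp (measurable_indic mT)).
exact: (@measurable_coord (mreal R)).
Qed.

(** By density, rational thresholds suffice, so that only countably many
    conditions on finite samples are involved. *)
Lemma measurable_ecdf_cauchy :
  measurable [set x : seqs (mreal R) | ecdf_cauchy x].
Proof.
(* The conditions are indexed by natural numbers: N + n and N + m run through the
   sizes from N on, and the rationals are enumerated by [unpickle]. *)
pose D (n m : nat) (q : rat) (k : nat) := [set x : seqs (mreal R) |
  `|ecdf x n (ratr q) - ecdf x m (ratr q)| <= k.+1%:R^-1].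
have mD n m q k : measurable (D n m q k).
  rewrite -[D _ _ _ _]setTI.
  have : measurable_fun setT (fun x : seqs (mreal R) =>
      `|ecdf x n (ratr q) - ecdf x m (ratr q)|).
    apply: measurableT_comp => //.
    by apply: measurable_funB; apply: measurable_relfreq; exact: measurable_itv.
  move=> /(_ measurableT `]-oo, k.+1%:R^-1]%classic).
  by rewrite set_itvE; apply; rewrite -set_itvNyc; exact: measurable_itv.
rewrite (_ : mkset _ = \bigcap_k \bigcup_N \bigcap_n \bigcap_m \bigcap_i
   D (N + n)%N (N + m)%N (odflt 0%R (@choice.unpickle rat i)) k).
  apply: bigcapT_measurable => k; apply: bigcupT_measurable => N.
  apply: bigcapT_measurable => n; apply: bigcapT_measurable => m.
  exact: bigcapT_measurable.
apply/seteqP; split => [x cx k _|x h e e0].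
  have [N hN] := cx k.+1%:R^-1 (ltac:(by rewrite invr_gt0)).
  by exists N => // n _ m _ i _; apply: hN; exact: leq_addr.
have [k ke] : exists k, k.+1%:R^-1 < e :> R.
  by have [k] := ltr_add_invr e0; rewrite add0r; exists k.
have [N _ hN] := h k I; exists N => n m t Nn Nm.
have [q hq] := ecdf_rat x (maxn n m) t.
rewrite !hq ?leq_maxl ?leq_maxr// (le_trans _ (ltW ke))//.
have := hN (n - N)%N I (m - N)%N I (choice.pickle q) I.
by rewrite /D/= !subnKC// choice.pickleK.
Qed.

Lemma measurable_empirical_law (A : set R) : measurable A ->
  measurable_fun [set x : seqs (mreal R) | ecdf_cauchy x]
    (fun x => empirical_law x A).
Proof.
apply: (measurable_kernel_pi measurable_ecdf_cauchy (measurable_rays R)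
  (@setI_rays R)) => _ [t ->].
apply: (emeasurable_fun_cvg (fun n (x : seqs (mreal R)) =>
  (relfreq x `]-oo, t]%classic n)%:E)).
  move=> n; apply/measurable_EFinP; apply: (measurable_funS measurableT) => //.
  by apply: measurable_relfreq; exact: measurable_itv.
by move=> x cx; apply: empirical_lawP => //; exact: interval_is_interval.
Qed.

Lemma measurable_empirical_lawT (A : set R) : measurable A ->
  measurable_fun setT (fun x : seqs (mreal R) => empirical_law x A).
Proof.
move=> mA; have mC := measurable_ecdf_cauchy.
rewrite -(setUv [set x : seqs (mreal R) | ecdf_cauchy x]).
apply/measurable_funU => //; first exact: measurableC.
split; first exact: measurable_empirical_law.
apply: (eq_measurable_fun (cst (\d_(0 : R) A))) => // x /set_mem nx.
by rewrite /empirical_law; case: pselect.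
Qed.

Lemma es_domE : @esR_dom R = [set x | ecdf_cauchy x].
Proof. by apply/seteqP; split => x /esR_dom_cauchy. Qed.

Let X := mreal R.

Let measurable_dom_es : measurable (@esR_dom R).
Proof. by rewrite es_domE; exact: measurable_ecdf_cauchy. Qed.

Let dom_es_sub : @esR_dom R `<=` pts (mpow X).
Proof. by []. Qed.

Let es_pts x : @esR_dom R x -> empirical_law x (pts X) = 1%E.
Proof. by move=> _; exact: probability_setT. Qed.

Let measurable_es (U : set X) : measurable U ->
  measurable_fun (@esR_dom R) (fun x => empirical_law x U).
Proof. by move=> mU; rewrite es_domE; exact: measurable_empirical_law. Qed.

Definition es_real : pker R (mpow X) X :=
  @PKer R (mpow X) X (@esR_dom R) (fun x => empirical_law x : probability X R)
    measurable_dom_es dom_es_sub es_pts measurable_es.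

(** The choice is harmless: measurability in the sequence follows from the
    prescribed values on cylinders. *)
Definition empirical_iprod (x : mpow X) : probability (mpow X) R :=
  sval (cid (ex_iprod (empirical_law x))).

Lemma empirical_iprodP x : is_iprod (X := X) (empirical_law x) (empirical_iprod x).
Proof. exact: (svalP (cid (ex_iprod (empirical_law x)))). Qed.

Let es_iprod_pts x : @esR_dom R x -> empirical_iprod x (pts (mpow X)) = 1%E.
Proof.
move=> _; rewrite (_ : pts (mpow X) = setT) ?probability_setT//.
by apply/seteqP; split.
Qed.

Let measurable_iprod (U : set (mpow X)) : measurable U ->
  measurable_fun (@esR_dom R) (fun x => empirical_iprod x U).
Proof.
apply: (measurable_kernel_pi _ (@measurable_rects X)
  (@setI_rects X)) => // _ [n [S [mS ->]]].
apply: (eq_measurable_fun (fun x : mpow X => \prod_(i < n) empirical_law x (S i))%E).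
  by move=> x _; rewrite empirical_iprodP.
elim: n => [|n ih]; first by under eq_fun do rewrite big_ord0; exact: measurable_cst.
under eq_fun do rewrite big_ord_recr/=.
by apply: emeasurable_funM => //; exact: measurable_es.
Qed.

Definition es_real_pow : pker R (mpow X) (mpow X) :=
  @PKer R (mpow X) (mpow X) (@esR_dom R) empirical_iprod
    measurable_dom_es dom_es_sub es_iprod_pts measurable_iprod.

Lemma is_ppow_es_real : is_ppow es_real es_real_pow.
Proof. by split => // x _; exact: empirical_iprodP. Qed.

Lemma is_esR_es_real : is_esR es_real.
Proof.
by split => // x /esR_dom_cauchy cx; exact: empirical_lawP.
Qed.

Lemma esR_measure_exists_unique (x : mpow X) : esR_dom x ->
  exists2 mu : probability X R, esR_measure x mu &
    forall nu : probability X R, esR_measure x nu ->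
      forall S : set R, measurable S -> nu S = mu S.
Proof.
move=> /esR_dom_cauchy/empirical_lawP h; exists (empirical_law x) => // nu hnu.
exact: (esR_measure_unique h hnu).
Qed.

Lemma es_real_permutation_invariant : permutation_invariant es_real.
Proof.
move=> s fs.
have xsE (x : mpow X) : esR_dom (x \o s : mpow X) <-> esR_dom x.
  by split=> /esR_dom_cauchy h; apply/esR_dom_cauchy; apply/(ecdf_cauchy_perm x fs).
have domE : dom (Defs.pcomp es_real (pperm R X s)) = dom es_real.
  apply/seteqP; split => x.
    move=> [_]; rewrite /= diracE; case: (boolP (_ \in _)) => [|_ /eqP].
      by move=> /set_mem/xsE.
    by rewrite eq_sym onee_eq0.
  by move=> dx; split => //=; rewrite diracE mem_set//; apply/xsE.
split => // x; rewrite domE => dx U mU; rewrite pcompE ?domE//.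
rewrite [LHS](@integral_dirac _ (mpow X) (x \o s) R (dom es_real)
  (measurable_dom es_real) (fun y : mpow X => es_real y U)); last first.
  exact: measurable_ker.
rewrite diracE mem_set ?mul1e; last exact/xsE.
exact: empirical_law_perm.
Qed.

End kernels.

(** * Deterministic comparison of two empirical distribution functions *)

Section deterministic.
Variable R : realType.
Implicit Types (x : nat -> R) (n m q L j : nat) (t e : R).

Definition rank_lt x m i : nat := (\sum_(l < m) (x l < x i)%R)%N.
Definition rank_le x m i : nat := (\sum_(l < m) (x l <= x i)%R)%N.

Lemma sum_bool_card m (p : pred 'I_m) : (\sum_(i < m) p i)%N = #|p|.
Proof.
rewrite -sum1_card [RHS]big_mkcond; apply: eq_bigr => i _.
by rewrite unfold_in; case: (p i).
Qed.

(** All observations counted are at most the largest of them, whose rank is at most c. *)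
Lemma card_rank_le x m c : (\sum_(i < m) (rank_le x m i <= c) <= c)%N.
Proof.
rewrite (sum_bool_card (fun i : 'I_m => rank_le x m i <= c)%N).
set S := (fun i : 'I_m => _).
have [i0 Si0|S0] := pickP S; last by rewrite eq_card0.
case: (arg_maxP (fun i : 'I_m => x i) Si0) => i Si imax.
apply: leq_trans Si; rewrite /rank_le (sum_bool_card (fun l : 'I_m => x l <= x i)%R).
by apply: subset_leq_card; apply/fintype.subsetP => l; rewrite !unfold_in => /imax.
Qed.

(** All observations strictly below the smallest one that is not counted are
    counted, and there are at least c of them. *)
Lemma card_rank_lt x m c : (c <= m)%N -> (c <= \sum_(i < m) (rank_lt x m i < c)%N)%N.
Proof.
move=> cm; rewrite (sum_bool_card (fun i : 'I_m => rank_lt x m i < c)%N).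
set S := (fun i : 'I_m => _).
have [i0 Si0|S0] := pickP (predC S); last first.
  rewrite eq_cardT ?size_enum_ord// => i; have := S0 i.
  by rewrite /= => /negbFE.
case: (arg_minP (fun i : 'I_m => x i) Si0) => i /= Si imin.
move: Si; rewrite /S -leqNgt => /leq_trans; apply.
rewrite /rank_lt (sum_bool_card (fun l : 'I_m => x l < x i)%R).
apply: subset_leq_card; apply/fintype.subsetP => l; rewrite !unfold_in.
by apply: contraLR => /imin; rewrite -leNgt.
Qed.

Definition avg_diff (p : nat -> bool) n m : R :=
  (\sum_(i < n) (p i)%:R) / n%:R - (\sum_(i < m) (p i)%:R) / m%:R.

Lemma ecdfE x n t : ecdf x n t = (\sum_(i < n) (x i <= t)%R%:R) / n%:R.
Proof.
rewrite /ecdf relfreqE; congr (_ / _); apply: eq_bigr => i _.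
suff -> : (x i \in `]-oo, t]%classic) = (x i <= t) by [].
by apply/idP/idP => [/set_mem|h]; rewrite ?inE/= in_itv.
Qed.

(** The events of rank at most or less than j q play the role of the half-lines
    bounded by the j-th of L empirical quantiles of the m observations.  Both kinds of
    rank are needed since ties may put much mass on a single quantile. *)
Lemma ecdf_sandwich x n m q L e : (0 < n)%N -> (0 < q)%N -> (0 < L)%N ->
  m = (q * L)%N ->
  (forall j, (j <= L)%N ->
    `|avg_diff (fun i => rank_lt x m i < j * q)%N n m| <= e /\
    `|avg_diff (fun i => rank_le x m i <= j * q)%N n m| <= e) ->
  forall t, `|ecdf x n t - ecdf x m t| <= e + L%:R^-1.
Proof.
move=> n0 q0 L0 mE h t.
have m0 : (0 < m)%N by rewrite mE muln_gt0 q0.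
have nR : 0 < n%:R^-1 :> R by rewrite invr_gt0 ltr0n.
have mR : 0 < m%:R^-1 :> R by rewrite invr_gt0 ltr0n.
pose c := (\sum_(l < m) (x l <= t)%R)%N.
have FmE : ecdf x m t = c%:R / m%:R by rewrite ecdfE /c natr_sum.
have cm : (c <= m)%N.
  by rewrite -[leqRHS]card_ord /c (sum_bool_card (fun l : 'I_m => x l <= t)%R) max_card.
have e0 : 0 <= e by have [/(le_trans (normr_ge0 _))] := h 0%N isT.
(* The value c/m of the larger sample lies between j/L and (j+1)/L. *)
pose j := (c %/ q)%N.
have jc : (j * q <= c)%N by exact: leq_trunc_div.
have cj : (c < j.+1 * q)%N by rewrite ltn_ceil.
have jL : (j <= L)%N.
  by rewrite -(leq_pmul2r q0) (leq_trans jc)// (leq_trans cm)// mE mulnC.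
have qm k : (k * q)%:R / m%:R = k%:R / L%:R :> R.
  rewrite mE !natrM; field.
  by rewrite !pnatr_eq0 -!lt0n q0 L0.
have jFm : j%:R / L%:R <= ecdf x m t.
  by rewrite -qm FmE ler_pM2r// ler_nat.
have Fmj : ecdf x m t <= j.+1%:R / L%:R.
  by rewrite -qm FmE ler_pM2r// ler_nat ltnW.
have jS : j.+1%:R / L%:R = j%:R / L%:R + L%:R^-1 :> R.
  by rewrite -natr1 mulrDl mul1r.
have lower : j%:R / L%:R - e <= ecdf x n t.
  have [+ _] := h j jL; rewrite /avg_diff ler_norml => /andP[+ _].
  have : (\sum_(i < n) (rank_lt x m i < j * q)%N%:R) / n%:R <= ecdf x n t :> R.
    rewrite ecdfE ler_pM2r// ler_sum// => i _; rewrite ler_nat.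
    have [xt|tx] := leP (x i) t; first by case: ltnP.
    rewrite ltnNge (leq_trans jc)//; apply: leq_sum => l _.
    by have [xlt|//] := leP (x l) t; rewrite (le_lt_trans xlt tx).
  have : (j * q)%:R / m%:R <= (\sum_(i < m) (rank_lt x m i < j * q)%N%:R) / m%:R :> R.
    rewrite ler_pM2r// -natr_sum ler_nat; apply: card_rank_lt.
    by rewrite (leq_trans jc).
  rewrite qm; lra.
have upper : ecdf x n t <= j.+1%:R / L%:R + e.
  (* For j = L there is no next quantile, but then t is above all the observations. *)
  have [jL'|Lj] := ltnP j L; last first.
    apply: (le_trans (relfreq_le1 _ _ _)).
    rewrite -[leLHS]addr0 lerD// ler_pdivlMr ?ltr0n// mul1r ler_nat ltnW//.
  have [_ +] := h j.+1 jL'; rewrite /avg_diff ler_norml => /andP[_].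
  have : ecdf x n t <= (\sum_(i < n) (rank_le x m i <= j.+1 * q)%N%:R) / n%:R :> R.
    rewrite ecdfE ler_pM2r// ler_sum// => i _; rewrite ler_nat.
    have [xt|//] := leP (x i) t.
    suff -> : (rank_le x m i <= j.+1 * q)%N by [].
    apply: leq_trans (ltnW cj); apply: leq_sum => l _.
    by have [xlt|//] := leP (x l) (x i); rewrite (le_trans xlt xt).
  have : (\sum_(i < m) (rank_le x m i <= j.+1 * q)%N%:R) / m%:R <=
      (j.+1 * q)%:R / m%:R :> R.
    by rewrite ler_pM2r// -natr_sum ler_nat; exact: card_rank_le.
  rewrite qm; lra.
rewrite ler_distl; lra.
Qed.

(** The count grows by at most n - p, and the normalisation by the factor n/p. *)
Lemma ecdf_gap x p n t : (0 < p)%N -> (p <= n)%N ->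
  `|ecdf x n t - ecdf x p t| <= (n - p)%:R / p%:R.
Proof.
move=> p0 pn; have n0 := leq_trans p0 pn.
rewrite !ecdfE.
have -> : \sum_(i < n) (x i <= t)%R%:R = \sum_(i < p) (x i <= t)%R%:R +
    \sum_(p <= i < n) (x i <= t)%R%:R :> R.
  by rewrite -!(big_mkord xpredT (fun i => (x i <= t)%R%:R)) (big_cat_nat _ pn).
set S := \sum_(i < p) _; set D := \sum_(p <= i < n) _.
have D0 : 0 <= D by apply: sumr_ge0.
have S0 : 0 <= S by apply: sumr_ge0.
have Dn : D <= (n - p)%:R.
  rewrite -[(n - p)%N]card_ord -sum1_card natr_sum /D -{1}[p]add0n big_addn big_mkord.
  by apply: ler_sum => i _; rewrite ler_nat leq_b1.
have Sp : S <= p%:R.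
  rewrite -[p]card_ord -sum1_card natr_sum /S.
  by apply: ler_sum => i _; rewrite ler_nat leq_b1.
have p0' : 0 < p%:R^-1 :> R by rewrite invr_gt0 ltr0n.
have n0' : 0 < n%:R^-1 :> R by rewrite invr_gt0 ltr0n.
have np : n%:R^-1 <= p%:R^-1 :> R by rewrite lef_pV2 ?posrE ?ltr0n// ler_nat.
have pp : p%:R * p%:R^-1 = 1 :> R by rewrite mulfV// pnatr_eq0 -lt0n.
have nn : n%:R * n%:R^-1 = 1 :> R by rewrite mulfV// pnatr_eq0 -lt0n.
rewrite natrB// in Dn *.
have pn' : p%:R <= n%:R :> R by rewrite ler_nat.
rewrite ler_norml; apply/andP; split.
  have h1 : S * (p%:R^-1 - n%:R^-1) <= p%:R * (p%:R^-1 - n%:R^-1).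
    by rewrite ler_wpM2r// subr_ge0.
  have h2 : (n%:R - p%:R) * n%:R^-1 <= (n%:R - p%:R) * p%:R^-1 :> R.
    by rewrite ler_wpM2l// subr_ge0.
  have h3 : 0 <= D * n%:R^-1 by rewrite mulr_ge0// ltW.
  rewrite mulrBr in h1; rewrite mulrBr in h1; rewrite mulrBl in h2 *.
  rewrite mulrDl; lra.
have h1 : (S + D) / n%:R <= (S + D) / p%:R by rewrite ler_wpM2l// addr_ge0.
have h2 : D / p%:R <= (n%:R - p%:R) / p%:R by rewrite ler_pM2r.
rewrite mulrDl in h1; rewrite mulrDl in h1; rewrite mulrDl; lra.
Qed.

(** An elementary form of convexity: (1 + u)^n is at most 1 + (2^n - 1) u for u in
    the unit interval, with u = 1/a. *)
Lemma expn_gap a n : (0 < a)%N -> (a.+1 ^ n.+1 <= a ^ n.+1 + (2 ^ n.+1).-1 * a ^ n)%N.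
Proof.
move=> a0; elim: n => [|n ih]; first by rewrite !expn1 expn0 addn1.
have := leq_mul (leqnn a.+1) ih; rewrite -expnS => /leq_trans; apply.
have an : (0 < a ^ n)%N by rewrite expn_gt0 a0.
have p2 : (0 < 2 ^ n)%N by rewrite expn_gt0.
rewrite !expnS; move: an p2; set A := (a ^ n)%N; set B := (2 ^ n)%N => an p2.
have -> : (2 * (2 * B)).-1 = ((2 * B).-1 * 2 + 1)%N by lia.
set C := (2 * B).-1.
have : (C * A <= C * (a * A))%N by rewrite leq_mul2l leq_pmull// orbT.
nia.
Qed.

Definition ecdf_steps_close x k := forall t,
  `|ecdf x (k.+1 ^ 8) t - ecdf x (k.+2 ^ 8) t| <= 2 / k.+2%:R ^+ 2.

(** The bound 2/(k+2)^2 is dominated by the telescoping term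
    2/(k+1) - 2/(k+2), which controls the checkpoints; between two of them
    [ecdf_gap] applies, as consecutive eighth powers have ratio 1 + O(1/k). *)
Lemma ecdf_cauchy_of_steps x K : (forall k, (K <= k)%N -> ecdf_steps_close x k) ->
  ecdf_cauchy x.
Proof.
move=> good.
pose a k := ecdf x (k.+1 ^ 8).
have aC k d t : (K <= k)%N ->
    `|a k t - a (k + d)%N t| <= 2 * (k.+1%:R^-1 - (k + d).+1%:R^-1).
  move=> Kk; elim: d => [|d ih]; first by rewrite addn0 !subrr normr0 mulr0.
  apply: (le_trans (ler_distD (a (k + d)%N t) _ _)).
  have := good (k + d)%N (leq_trans Kk (leq_addr _ _)) t.
  rewrite -!/(a _ _) addnS => hg; apply: (le_trans (lerD ih hg)).
  have -> : 2 * (k.+1%:R^-1 - (k + d).+2%:R^-1) =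
    2 * (k.+1%:R^-1 - (k + d).+1%:R^-1) +
    2 * ((k + d).+1%:R^-1 - (k + d).+2%:R^-1) :> R by ring.
  rewrite lerD2l ler_wpM2l//.
  set u : R := (k + d).+1%:R; have u1 : 0 < u by rewrite ltr0n.
  have -> : (k + d).+2%:R = u + 1 by rewrite /u natr1.
  have -> : u^-1 - (u + 1)^-1 = (u * (u + 1))^-1 by field; lra.
  rewrite lef_pV2 ?posrE ?mulr_gt0 ?exprn_gt0; nra.
(* The constant is 255 = 2^8 - 1 from [expn_gap] plus 2 from the checkpoints. *)
have near_a k n t : (K <= k)%N -> (k.+1 ^ 8 <= n)%N ->
    `|ecdf x n t - a k t| <= 257 / k.+1%:R.
  move=> Kk kn.
  have [l [kl ln nl]] : exists l, [/\ (k <= l)%N, (l.+1 ^ 8 <= n)%N & (n < l.+2 ^ 8)%N].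
    have ex : exists l, (n < l.+2 ^ 8)%N.
      exists n; rewrite (leq_trans (ltnSn n))// (leq_trans (leqnSn _))//.
      by rewrite -[leqLHS]expn1 leq_exp2l.
    case: (ex_minnP ex) => l nl lmin; exists l; split => //.
      by have := leq_ltn_trans kn nl; rewrite ltn_exp2r// !ltnS.
    case: l nl lmin => [_ _|l _ lmin]; first by rewrite exp1n (leq_trans _ kn)// expn_gt0.
    by rewrite leqNgt; apply/negP => /lmin; rewrite ltnn.
  apply: (le_trans (ler_distD (a l t) _ _)).
  have lk : (l.+1%:R^-1 : R) <= k.+1%:R^-1 by rewrite lef_pV2 ?posrE// ler_nat ltnS.
  have gap : `|ecdf x n t - a l t| <= 255 / l.+1%:R.
    apply: (le_trans (ecdf_gap x t _ ln)); first by rewrite expn_gt0.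
    rewrite ler_pdivrMr ?ltr0n ?expn_gt0//.
    have -> : 255 / l.+1%:R * (l.+1 ^ 8)%:R = (255 * l.+1 ^ 7)%:R :> R.
      rewrite (expnS _ 7) !natrM mulrA; congr (_ * _).
      by rewrite mulfVK// pnatr_eq0.
    rewrite ler_nat leq_subLR (leq_trans (ltnW nl))//.
    exact: (@expn_gap l.+1 7).
  have := aC k (l - k)%N t Kk; rewrite subnKC// => close.
  rewrite (distrC (a l t) (a k t)).
  have l0 : 0 <= (l.+1%:R^-1 : R) by rewrite invr_ge0.
  apply: (le_trans (lerD gap close)); move: lk l0.
  by set u := l.+1%:R^-1; set v := k.+1%:R^-1 => uv u0; lra.
move=> e e0.
have [k0 k0e] : exists k : nat, 514 / k.+1%:R <= e.
  have [k] := ltr_add_invr (divr_gt0 e0 (ltr0Sn R 513)); rewrite add0r => h.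
  by exists k; rewrite mulrC -ler_pdivlMr// ltW.
pose k := maxn k0 K.
exists (k.+1 ^ 8)%N => n m t kn km.
have Kk : (K <= k)%N by rewrite leq_maxr.
apply: (le_trans (ler_distD (a k t) _ _)).
have h1 := near_a k n t Kk kn; have h2 := near_a k m t Kk km.
rewrite (distrC (a k t)); apply: (le_trans (lerD h1 h2)).
have h : 514 / k.+1%:R <= e.
  by apply: le_trans k0e; rewrite ler_pM2l// lef_pV2 ?posrE// ler_nat ltnS leq_maxl.
by apply: le_trans h; rewrite -mulrDl -natrD.
Qed.

End deterministic.

(** * Second moments of weighted sums of indicators *)

Section second_moment.
Context d (T : measurableType d) (R : realType) (P : probability T R).

Lemma integrable_indicZ (A : set T) (r : R) : measurable A ->
  P.-integrable setT (EFin \o (fun x => r * \1_A x)).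
Proof.
move=> mA.
apply: (@measurable_bounded_integrable _ _ _ P) => //.
- by rewrite (le_lt_trans (probability_le1 _ _))// ltry.
- by apply: measurable_funM => //; exact: measurable_indic.
exists `|r|; split; first exact: num_real.
move=> M rM x _ /=; rewrite normrM (le_trans _ (ltW rM))// ler_piMr//.
by rewrite indicE; case: (_ \in _); rewrite ?normr1 ?normr0.
Qed.

Lemma Rintegral_indicZ (A : set T) (r : R) : measurable A ->
  \int[P]_x (r * \1_A x) = r * fine (P A).
Proof.
move=> mA; rewrite RintegralZl//; last first.
  have := integrable_indicZ 1 mA; apply: eq_integrable => // x _ /=.
  by rewrite mul1r.
by rewrite /Rintegral integral_indic// setIT.
Qed.

Lemma Rintegral_sum (I : Type) (s : seq I) (f : I -> T -> R) :
  (forall i, P.-integrable setT (EFin \o f i)) ->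
  \int[P]_x (\sum_(i <- s) f i x) = \sum_(i <- s) \int[P]_x f i x.
Proof.
move=> fi; elim: s => [|i s ih].
  rewrite big_nil (@eq_Rintegral _ _ _ _ _ (fun=> 0)).
    by rewrite Rintegral_cst// mul0r.
  by move=> x _; rewrite big_nil.
rewrite big_cons -ih -RintegralD//.
  by apply: eq_Rintegral => x _; rewrite big_cons.
have := integrable_sum (measurableT : measurable [set: T]) s (P := xpredT)
  (fun i _ => fi i).
by apply: eq_integrable => // x _ /=; rewrite sumEFin.
Qed.

(** Only the diagonal survives: as the weights sum to 0, subtracting the constant b
    from all joint probabilities does not change the quadratic form. *)
Lemma Rintegral_sum_indic_sq m (A : 'I_m -> set T) (w : 'I_m -> R) (a b : R) :
  (forall i, measurable (A i)) ->
  (forall i, fine (P (A i)) = a) ->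
  (forall i j, i != j -> fine (P (A i `&` A j)) = b) ->
  \sum_i w i = 0 ->
  \int[P]_x ((\sum_i w i * \1_(A i) x) ^+ 2) = (a - b) * \sum_i w i ^+ 2.
Proof.
move=> mA Aa Ab w0.
transitivity (\sum_i \sum_j w i * w j * fine (P (A i `&` A j))).
  rewrite (@eq_Rintegral _ _ _ _ _
      (fun x => \sum_i \sum_j (w i * w j) * \1_(A i `&` A j) x)).
    rewrite Rintegral_sum; last first.
      move=> i; have := integrable_sum (measurableT : measurable [set: T])
        (index_enum 'I_m) (P := xpredT)
        (fun j _ => integrable_indicZ (w i * w j) (measurableI _ _ (mA i) (mA j))).
      by apply: eq_integrable => // x _ /=; rewrite sumEFin.
    apply: eq_bigr => i _; rewrite Rintegral_sum; last first.
      by move=> j; apply: integrable_indicZ; exact: measurableI.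
    by apply: eq_bigr => j _; rewrite Rintegral_indicZ//; exact: measurableI.
  move=> x _; rewrite expr2 mulr_suml; apply: eq_bigr => i _.
  rewrite mulr_sumr; apply: eq_bigr => j _.
  by rewrite indicI/=; ring.
transitivity (\sum_i (\sum_j w i * w j * b + w i ^+ 2 * (a - b))).
  apply: eq_bigr => i _; rewrite (bigD1 i)//= [in RHS](bigD1 i)//= setIid Aa.
  rewrite (eq_bigr (fun j => w i * w j * b)); last by move=> j ji; rewrite Ab// eq_sym.
  by ring.
rewrite big_split/= -mulr_suml [RHS]mulrC [X in X + _]big1 ?add0r// => i _.
by rewrite -mulr_suml -mulr_sumr w0 mulr0 mul0r.
Qed.

Lemma measurable_norm_ge (D : T -> R) (e : R) : measurable_fun setT D ->
  measurable [set x | e <= `|D x|].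
Proof.
move=> mD; rewrite (_ : mkset _ = (fun x => `|D x|) @^-1` `[e, +oo[%classic).
  rewrite -[X in measurable X]setTI.
  by apply: (measurableT_comp _ mD) => //; exact: measurable_itv.
by apply/seteqP; split => x /=; rewrite in_itv/= andbT.
Qed.

Lemma chebyshev_sq (D : T -> R) (e M : R) : 0 < e -> measurable_fun setT D ->
  (forall x, `|D x| <= M) ->
  e ^+ 2 * fine (P [set x | e <= `|D x|]) <= \int[P]_x (D x ^+ 2).
Proof.
move=> e0 mD DM.
have mE := measurable_norm_ge e mD.
rewrite -Rintegral_indicZ//; apply: le_Rintegral => //.
- exact: integrable_indicZ.
- apply: (@measurable_bounded_integrable _ _ _ P) => //.
  + by rewrite (le_lt_trans (probability_le1 _ _))// ltry.
  + exact: measurable_funX.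
  exists (M ^+ 2); split; first exact: num_real.
  move=> N MN x _ /=; rewrite normrX (le_trans _ (ltW MN))// ler_pXn2r ?nnegrE//.
  exact: le_trans (DM x).
- move=> x _; rewrite indicE; have [xE|xE] := boolP (x \in _).
    move: xE; rewrite inE/= mulr1 -(real_normK (num_real (D x))) => eD.
    by rewrite ler_pXn2r ?nnegrE// ltW.
  by rewrite mulr0 sqr_ge0.
Qed.

End second_moment.

(** * Exchangeable events *)

Section exchangeable_sequence.
Context d (T : measurableType d) (R : realType) (P : probability T R).
Variable tau : (nat -> nat) -> T -> T.
Hypothesis Ptau : forall s U, finite_perm s -> measurable U ->
  P (tau s @^-1` U) = P U.

Definition swap (a b i : nat) : nat :=
  if i == a then b else if i == b then a else i.

Lemma swapK a b : involutive (swap a b).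
Proof.
move=> i; rewrite /swap; have [->|ia] := eqVneq i a.
  by rewrite eqxx; case: eqVneq.
by have [->|ib] := eqVneq i b; rewrite ?eqxx// (negbTE ia) (negbTE ib).
Qed.

Lemma finite_perm_swap a b : finite_perm (swap a b).
Proof.
split; first by exists (swap a b); exact: swapK.
apply: (@sub_finite_set _ _ [set a; b]); last exact: finite_set2.
move=> i /=; rewrite /swap; case: eqP => [->|_]; first by left.
by case: eqP => [->|_ []//]; right.
Qed.

Lemma swap_lt m a b i : (a < m)%N -> (b < m)%N -> (i < m)%N -> (swap a b i < m)%N.
Proof. by move=> am bm im; rewrite /swap; case: ifP => // _; case: ifP. Qed.

(** The permutation [tau s] of the sample space acts on the indexed family of events
    through its index. *)
Definition equivariant m (A : nat -> set T) := forall a b i,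
  (a < m)%N -> (b < m)%N -> (i < m)%N ->
  tau (swap a b) @^-1` A i = A (swap a b i).

Lemma equivariant_prob m (A : nat -> set T) i : (forall i, measurable (A i)) ->
  equivariant m A -> (i < m)%N -> P (A i) = P (A 0%N).
Proof.
move=> mA eA im; rewrite -(Ptau (finite_perm_swap 0 i) (mA 0%N)) eA//;
  exact: leq_ltn_trans im.
Qed.

(** Two transpositions take any pair of indices to the pair 0, 1. *)
Lemma equivariant_prob2 m (A : nat -> set T) i j : (forall i, measurable (A i)) ->
  equivariant m A -> (i < m)%N -> (j < m)%N -> i != j ->
  P (A i `&` A j) = P (A 0%N `&` A 1%N).
Proof.
move=> mA eA im jm ij.
have m0 : (0 < m)%N by exact: leq_ltn_trans im.
have eA2 a b k l : (a < m)%N -> (b < m)%N -> (k < m)%N -> (l < m)%N ->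
    P (A k `&` A l) = P (A (swap a b k) `&` A (swap a b l)).
  move=> am bm km lm; rewrite -(Ptau (finite_perm_swap a b))//; last exact: measurableI.
  by rewrite preimage_setI !eA.
rewrite (eA2 0%N i)//.
have -> : swap 0 i i = 0%N by rewrite /swap eqxx; case: eqP.
set k := swap 0 i j.
have km : (k < m)%N by exact: swap_lt.
have k0 : k != 0%N.
  rewrite /k /swap (eq_sym j i) (negbTE ij).
  by have [j0|//] := eqVneq j 0%N; rewrite -j0.
have m1 : (1 < m)%N by rewrite (leq_ltn_trans _ km)// lt0n.
rewrite (eA2 1%N k)//; congr (P (A _ `&` A _)).
  by rewrite /swap/= (eq_sym 0%N) (negbTE k0).
by rewrite /swap; have [->|_] := eqVneq k 1%N; rewrite ?eqxx.
Qed.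

Lemma avg_diff_indic (A : nat -> set T) n m w : (n <= m)%N ->
  avg_diff R (fun i => w \in A i) n m =
  \sum_(i < m) ((i < n)%N%:R / n%:R - m%:R^-1) * \1_(A i) w.
Proof.
move=> nm; rewrite /avg_diff [RHS](eq_bigr (fun i : 'I_m =>
  (i < n)%N%:R / n%:R * (w \in A i)%:R + - (m%:R^-1 * (w \in A i)%:R))); last first.
  by move=> i _; rewrite indicE mulrBl.
rewrite big_split/= sumrN -mulr_sumr [m%:R^-1 * _]mulrC; congr (_ - _).
rewrite -!(big_mkord xpredT (fun i => (w \in A i)%:R)) .
rewrite -(big_mkord xpredT (fun i => (i < n)%N%:R / n%:R * (w \in A i)%:R)).
rewrite (big_cat_nat _ nm)//= [X in _ = _ + X]big_nat_cond.
rewrite [X in _ = _ + X]big1; last first.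
  by move=> i /andP[/andP[ni _] _]; rewrite ltnNge ni/= !mul0r.
rewrite addr0 mulr_suml; apply: eq_big_nat => i /andP[_ iln].
by rewrite iln mul1r mulrC.
Qed.

(** The sum of squares is in fact 1/n - 1/m. *)
Lemma avg_weights n m : (0 < n)%N -> (n <= m)%N ->
  \sum_(i < m) ((i < n)%N%:R / n%:R - m%:R^-1) = 0 :> R /\
  \sum_(i < m) ((i < n)%N%:R / n%:R - m%:R^-1) ^+ 2 <= n%:R^-1 :> R.
Proof.
move=> n0 nm; have m0 := leq_trans n0 nm.
have Sn : \sum_(i < m) (i < n)%N%:R = n%:R :> R.
  rewrite -natr_sum -(big_mkord xpredT (fun i => (i < n)%N : nat)) (big_cat_nat _ nm)//=.
  rewrite [X in (_ + X)%N]big_nat_cond [X in (_ + X)%N]big1; last first.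
    by move=> i /andP[/andP[ni _] _]; rewrite ltnNge ni.
  rewrite addn0 (eq_big_nat _ _ (F2 := fun=> 1%N)); last by move=> i /andP[_ ->].
  by rewrite sum_nat_const_nat subn0 muln1.
have nn : n%:R * n%:R^-1 = 1 :> R by rewrite mulfV// pnatr_eq0 -lt0n.
have mm : m%:R * m%:R^-1 = 1 :> R by rewrite mulfV// pnatr_eq0 -lt0n.
have cst (c : R) : \sum_(i < m) c = m%:R * c.
  by rewrite sumr_const card_ord mulr_natl.
split; first by rewrite sumrB -mulr_suml Sn cst nn mm subrr.
rewrite (eq_bigr (fun i : 'I_m => (i < n)%N%:R * (n%:R^-1 ^+ 2 - 2 * n%:R^-1 * m%:R^-1) +
   m%:R^-1 ^+ 2)); last first.
  by move=> i _; case: (i < n)%N => /=; ring.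
rewrite big_split/= -mulr_suml Sn cst.
have m1 : 0 <= m%:R^-1 :> R by rewrite invr_ge0.
set u := n%:R^-1 in nn *; set v := m%:R^-1 in mm m1 *.
have -> : n%:R * (u ^+ 2 - 2 * u * v) = (n%:R * u) * u - 2 * (n%:R * u) * v by ring.
have -> : m%:R * v ^+ 2 = (m%:R * v) * v by ring.
rewrite nn mm; lra.
Qed.

Lemma prob_avg_diff (A : nat -> set T) n m (e : R) : (0 < n)%N -> (n <= m)%N -> 0 < e ->
  (forall i, measurable (A i)) -> equivariant m A ->
  (P [set w : T | (e <= `|avg_diff R (fun i => w \in A i) n m|)%R] <=
   (n%:R^-1 / e ^+ 2)%:E)%E.
Proof.
move=> n0 nm e0 mA eA; have [w0 w2] := avg_weights n0 nm.
set w := (fun i : 'I_m => (i < n)%N%:R / n%:R - m%:R^-1 : R) in w0 w2.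
have DE x : avg_diff R (fun i => x \in A i) n m = \sum_i w i * \1_(A i) x.
  exact: avg_diff_indic.
set E := mkset _.
have mD : measurable_fun setT (fun x => \sum_(i < m) w i * \1_(A i) x).
  by apply: measurable_sum => i; apply: measurable_funM => //; exact: measurable_indic.
rewrite (_ : E = [set x | e <= `|\sum_i w i * \1_(A i) x|]); last first.
  by rewrite /E; apply/seteqP; split => x /=; rewrite DE.
have DM x : `|\sum_i w i * \1_(A i) x| <= \sum_i `|w i|.
  apply: (le_trans (ler_norm_sum _ _ _)); apply: ler_sum => i _.
  by rewrite normrM ler_piMr// indicE; case: (_ \in _); rewrite ?normr1 ?normr0.
have := chebyshev_sq P e0 mD DM.
rewrite (Rintegral_sum_indic_sq (P := P) (a := fine (P (A 0%N)))
  (b := fine (P (A 0%N `&` A 1%N))))//; last 2 first.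
  by move=> i; rewrite (equivariant_prob mA eA).
  by move=> i j ij; rewrite (equivariant_prob2 mA eA).
move=> h; rewrite -[leLHS]fineK ?fin_num_measure//; last first.
  exact: measurable_norm_ge.
rewrite lee_fin ler_pdivlMr ?exprn_gt0// mulrC (le_trans h)// (le_trans _ w2)//.
rewrite ler_piMl//; first by apply: sumr_ge0 => i _; exact: sqr_ge0.
have : fine (P (A 0%N)) <= 1 by rewrite -lee_fin fineK ?fin_num_measure ?probability_le1.
have : 0 <= fine (P (A 0%N `&` A 1%N)) by rewrite fine_ge0.
lra.
Qed.

End exchangeable_sequence.

(** * Almost sure uniform convergence for exchangeable sequences *)

Section exchangeable_ecdf.
Context d (T : measurableType d) (R : realType) (P : probability T R).
Variables (X : nat -> T -> R) (tau : (nat -> nat) -> T -> T).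
Hypothesis mX : forall i, measurable_fun setT (X i).
Hypothesis Ptau : forall s U, finite_perm s -> measurable U ->
  P (tau s @^-1` U) = P U.
Hypothesis Xtau : forall s i w, X i (tau s w) = X (s i) w.

Let x (w : T) : nat -> R := fun i => X i w.

(** The event that the i-th among the first m observations has rank less than c
    (for [r = true]) or at most c (for [r = false]). *)
Let A (r : bool) m c i : set T :=
  [set w | if r then (rank_lt (x w) m i < c)%N else (rank_le (x w) m i <= c)%N].

Let measurable_natsum m (b : nat -> T -> bool) c :
  (forall l, measurable_fun setT (b l)) ->
  measurable [set w | (\sum_(l < m) b l w <= c)%N].
Proof.
move=> mb; rewrite -[X in measurable X]setTI.
have mf : measurable_fun setT (fun w => \sum_(l < m) \1_(b l @^-1` [set true]) w : R).
  apply: measurable_sum => l; apply: measurable_indic.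
  by rewrite -[X in measurable X]setTI; exact: mb.
rewrite (_ : mkset _ =
  (fun w => \sum_(l < m) \1_(b l @^-1` [set true]) w : R) @^-1` `]-oo, c%:R]%classic).
  by apply: mf => //; exact: measurable_itv.
apply/seteqP; split => w /=; rewrite in_itv/= -(ler_nat R) natr_sum;
  congr (is_true (_ <= _)); apply: eq_bigr => l _; rewrite indicE;
  (case blw : (b l w); [rewrite mem_set|rewrite memNset//= blw]) => //.
Qed.

Let mA r m c i : measurable (A r m c i).
Proof.
rewrite /A; case: r.
  case: c => [|c].
    rewrite (_ : mkset _ = set0); first exact: measurable0.
    by apply/seteqP; split => w.
  by apply: (@measurable_natsum m (fun l w => x w l < x w i) c) => l;
    apply: measurable_fun_ltr; exact: mX.
by apply: (@measurable_natsum m (fun l w => x w l <= x w i) c) => l;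
    apply: measurable_fun_ler; exact: mX.
Qed.

Let eA r m c : equivariant tau m (A r m c).
Proof.
move=> a b i am bm im.
pose h (l : 'I_m) : 'I_m := Ordinal (swap_lt am bm (ltn_ord l)).
have hinj : injective h.
  by move=> k l /(congr1 val)/= /(can_inj (swapK a b)) kl; exact: val_inj.
have xE w l : x (tau (swap a b) w) l = x w (swap a b l) by rewrite /x Xtau.
have E1 w : rank_lt (x (tau (swap a b) w)) m i = rank_lt (x w) m (swap a b i).
  rewrite /rank_lt [RHS](reindex_inj hinj); apply: eq_bigr => l _.
  by rewrite !xE.
have E2 w : rank_le (x (tau (swap a b) w)) m i = rank_le (x w) m (swap a b i).
  rewrite /rank_le [RHS](reindex_inj hinj); apply: eq_bigr => l _.
  by rewrite !xE.
by apply/seteqP; split => w; rewrite /A /=; case: r; rewrite ?E1 ?E2.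
Qed.

Let E (r : bool) n m c (e : R) : set T :=
  [set w | e <= `|avg_diff R (fun i => w \in A r m c i) n m|].

Let mE r n m c e : measurable (E r n m c e).
Proof.
apply: measurable_norm_ge; apply: measurable_funB; apply: measurable_funM => //;
  by apply: measurable_sum => i; exact: measurable_indic.
Qed.

Let bad_at k j : set T :=
  E true (k.+1 ^ 8) (k.+2 ^ 8) (j * k.+2 ^ 6) (k.+2%:R ^+ 2)^-1 `|`
  E false (k.+1 ^ 8) (k.+2 ^ 8) (j * k.+2 ^ 6) (k.+2%:R ^+ 2)^-1.

(** At checkpoint k, some frequency below a quantile differs by at least
    1/(k+2)^2 between the two samples. *)
Let bad k : set T := \big[setU/set0]_(j < (k.+2 ^ 2).+1) bad_at k j.

Let mbad k : measurable (bad k).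
Proof. by apply: bigsetU_measurable => j _; apply: measurableU; exact: mE. Qed.

Let pow_le k : (k.+1 ^ 8 <= k.+2 ^ 8)%N.
Proof. by rewrite leq_exp2r. Qed.

Let PE r k c : (P (E r (k.+1 ^ 8) (k.+2 ^ 8) c (k.+2%:R ^+ 2)^-1) <=
  ((k.+2 ^ 4)%:R / (k.+1 ^ 8)%:R)%:E)%E.
Proof.
apply: (le_trans (prob_avg_diff Ptau _ (pow_le k) _ (mA r _ _) (@eA r _ _))).
- by rewrite expn_gt0.
- by rewrite invr_gt0 exprn_gt0.
by rewrite lee_fin exprVn invrK -exprM [leLHS]mulrC !natrX.
Qed.

(** There are about (k+2)^2 quantiles, each contributing at most
    2 (k+2)^4/(k+1)^8, so that the total is of order 1/k^2; the telescoping form makes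
    the series summable at sight. *)
Let Pbad k : (P (bad k) <= (320 * (k.+1%:R^-1 - k.+2%:R^-1))%:E)%E.
Proof.
apply: (@le_trans _ _ (\sum_(j < (k.+2 ^ 2).+1)
    ((k.+2 ^ 4)%:R / (k.+1 ^ 8)%:R * 2)%:E)%E).
  apply: le_trans.
    apply: (@Boole_inequality _ _ _ _ (bad_at k)).
    by move=> j _; apply: measurableU; exact: mE.
  apply: lee_sum => j _; rewrite mulr_natr mulr2n EFinD.
  by apply: (le_trans (measureU2 _ _ _)) => //; apply: leeD; exact: PE.
rewrite sumEFin lee_fin sumr_const card_ord -[leLHS]mulr_natl.
have : ((k.+2 ^ 2).+1 <= 5 * k.+1 ^ 2)%N by nia.
have : (k.+2 ^ 4 <= 16 * k.+1 ^ 4)%N.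
  rewrite (_ : 16 = 2 ^ 4)%N// -expnMn leq_exp2r//; lia.
rewrite -(ler_nat R) => h4; rewrite -(ler_nat R) => h5.
set a : R := k.+1%:R; have a0 : 1 <= a by rewrite ler1n.
have -> : k.+2%:R = a + 1 :> R by rewrite /a natr1.
have -> : a^-1 - (a + 1)^-1 = (a * (a + 1))^-1 by field; lra.
rewrite natrM [(k.+1 ^ 4)%:R]natrX -/a in h4.
rewrite natrM [(k.+1 ^ 2)%:R]natrX -/a in h5.
rewrite [(k.+1 ^ 8)%:R]natrX -/a.
have a8 : 0 < (a ^+ 8)^-1 by rewrite invr_gt0 exprn_gt0; lra.
apply: (@le_trans _ _ (5 * a ^+ 2 * (16 * a ^+ 4 / a ^+ 8 * 2))).
  apply: ler_pM => //; first by rewrite !mulr_ge0 ?exprn_ge0 ?ltW.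
  by rewrite ler_pM2r// ler_pM2r.
have -> : 5 * a ^+ 2 * (16 * a ^+ 4 / a ^+ 8 * 2) = 160 / a ^+ 2 by field; lra.
have aa : 0 < a * (a + 1) by nra.
rewrite expr2 ler_pdivrMr; last by nra.
by rewrite mulrAC ler_pdivlMr//; nra.
Qed.

(** Borel-Cantelli excludes the bad events for large k. *)
Lemma exchangeable_ecdf_cauchy :
  measurable [set w | ecdf_cauchy (x w)] -> P [set w | ecdf_cauchy (x w)] = 1%E.
Proof.
move=> mC; set C := [set w | _].
suff : P (~` C) = 0%E.
  move=> PC; rewrite -[C]setCK probability_setC ?PC ?sube0//.
  exact: measurableC.
apply/eqP; rewrite -measure_le0 -[leRHS](@lim_sup_set_cvg0 _ _ _ P bad)//; last first.
  apply: (@le_lt_trans _ _ 320%:E); last exact: ltry.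
  apply: lime_le; first exact: is_cvg_nneseries.
  apply: nearW => n.
  apply: (@le_trans _ _ (\sum_(0 <= k < n) (320 * (k.+1%:R^-1 - k.+2%:R^-1))%:E)%E).
    by apply: lee_sum => k _; exact: Pbad.
  rewrite sumEFin lee_fin -mulr_sumr.
  have -> : \sum_(0 <= k < n) (k.+1%:R^-1 - k.+2%:R^-1) = 1 - n.+1%:R^-1 :> R.
    elim: n => [|n ih]; first by rewrite big_geq// invr1 subrr.
    by rewrite big_nat_recr//= ih addrA subrK.
  by rewrite ler_piMr// gerBl invr_ge0.
apply: le_measure; rewrite ?inE.
- exact: measurableC.
- by apply: bigcap_measurable => // i _; apply: bigcup_measurable => k _; exact: mbad.
move=> w Cw K _; apply: contrapT => ngood; apply: Cw.
apply: (@ecdf_cauchy_of_steps _ _ K) => k Kk t.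
have gk : ~ bad k w by move=> bk; apply: ngood; exists k.
(* One half of the bound is the deviation of the frequencies, the other is the mesh
   of the quantiles. *)
have -> : 2 / k.+2%:R ^+ 2 = (k.+2%:R ^+ 2)^-1 + (k.+2 ^ 2)%:R^-1 :> R.
  by rewrite natrX mulr_natl mulr2n.
apply: (@ecdf_sandwich _ _ _ _ (k.+2 ^ 6) (k.+2 ^ 2)); rewrite ?expn_gt0//.
  by rewrite -expnD.
move=> j jL.
have : ~ bad_at k j w.
  by move=> h; apply: gk; rewrite /bad -(bigcup_mkord _ (bad_at k)); exists j.
have memA r i : (w \in A r (k.+2 ^ 8) (j * k.+2 ^ 6) i) =
    if r then (rank_lt (x w) (k.+2 ^ 8) i < j * k.+2 ^ 6)%N
    else (rank_le (x w) (k.+2 ^ 8) i <= j * k.+2 ^ 6)%N.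
  by apply/idP/idP => [/set_mem|h]; [|apply/mem_set].
move=> /not_orP[]; rewrite /E /= => /negP; rewrite -ltNge => h1.
move=> /negP; rewrite -ltNge => h2.
split; apply: ltW.
  by move: h1; congr (is_true (`|avg_diff R _ _ _| < _)); apply/funext => i; rewrite memA.
by move: h2; congr (is_true (`|avg_diff R _ _ _| < _)); apply/funext => i; rewrite memA.
Qed.

End exchangeable_ecdf.

(** * Integrals of functions with values in the unit interval *)

Section bounded_integrals.
Context d (T : measurableType d) (R : realType) (P : probability T R).

Definition unit_mfun (f : T -> R) :=
  measurable_fun setT f /\ forall w, 0 <= f w <= 1.

Lemma unit_mfun_integrable f : unit_mfun f -> P.-integrable setT (EFin \o f).
Proof.
move=> [mf f01]; apply: (@measurable_bounded_integrable _ _ _ P) => //.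
  by rewrite (le_lt_trans (probability_le1 _ _))// ltry.
exists 1; split; first exact: num_real.
move=> M M1 w _ /=; have /andP[f0 f1] := f01 w.
by rewrite ger0_norm// (le_trans f1)// ltW.
Qed.

Lemma unit_mfunM f g : unit_mfun f -> unit_mfun g -> unit_mfun (fun w => f w * g w).
Proof.
move=> [mf f01] [mg g01]; split; first exact: measurable_funM.
by move=> w; have /andP[? ?] := f01 w; have /andP[? ?] := g01 w;
  rewrite mulr_ge0//= mulr_ile1.
Qed.

Lemma unit_mfun_prod (I : eqType) (s : seq I) (p : pred I) (f : I -> T -> R) :
  (forall i, unit_mfun (f i)) -> unit_mfun (fun w => \prod_(i <- s | p i) f i w).
Proof.
move=> uf; split.
  under eq_fun do rewrite big_mkcond.
  by apply: measurable_prod => i _; case: (p i) => //; have [] := uf i.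
move=> w; apply/andP; split.
  by apply: prodr_ge0 => i _; have [_ /(_ w)/andP[]] := uf i.
by apply: prodr_ile1 => i _; have [_ /(_ w)] := uf i.
Qed.

Lemma unit_mfun_indic (A : set T) : measurable A -> unit_mfun (\1_A).
Proof.
move=> mA; split; first exact: measurable_indic.
by move=> w; rewrite indicE; case: (_ \in _); rewrite ?lexx ler01.
Qed.

Lemma unit_mfun_kernel (Q : T -> probability R R) (S : set R) :
  measurable_fun setT (fun w => Q w S) -> measurable S ->
  unit_mfun (fun w => fine (Q w S)).
Proof.
move=> mQ mS; split; first exact: measurableT_comp.
move=> w; rewrite -!lee_fin fineK ?fin_num_measure//.
by rewrite measure_ge0 probability_le1.
Qed.

(** Dominated convergence with the constant 1 as the dominating function. *)
Lemma bounded_Rintegral_cvg (f_ : nat -> T -> R) (f : T -> R) (C : set T) :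
  measurable C -> P C = 1%E ->
  (forall n, unit_mfun (f_ n)) -> unit_mfun f ->
  (forall w, C w -> f_ n w @[n --> \oo] --> f w) ->
  \int[P]_w f_ n w @[n --> \oo] --> \int[P]_w f w.
Proof.
move=> mC PC uf_ uf cvf.
have CN : P (~` C) = 0%E by rewrite probability_setC// PC subee.
have aeC (Q : T -> Prop) : (forall w, C w -> Q w) -> \forall w \ae P, Q w.
  move=> CQ; exists (~` C); split => //; first exact: measurableC.
  by move=> w /= nQ Cw; apply: nQ; exact: CQ.
have m_ n : measurable_fun setT (EFin \o f_ n).
  by apply/measurable_EFinP; have [] := uf_ n.
have m0 : measurable_fun setT (EFin \o f).
  by apply/measurable_EFinP; have [] := uf.
have h1 : \forall w \ae P, setT w -> (EFin \o f_ n) w @[n --> \oo] --> (EFin \o f) w.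
  by apply: aeC => w Cw _; apply: cvg_EFin; [exact: nearW|exact: cvf].
have h2 : P.-integrable setT (cst 1%E : T -> \bar R).
  exact: finite_measure_integrable_cst.
have h3 : \forall w \ae P, forall n, setT w -> (`|(EFin \o f_ n) w| <= cst 1%E w)%E.
  apply: aeC => w _ n _; have [_ /(_ w)/andP[f0 f1]] := uf_ n.
  by rewrite /= lee_fin ger0_norm.
have [fi _ h] := dominated_convergence measurableT m_ m0 h1 h2 h3.
apply: fine_cvg; rewrite fineK; first exact: h.
exact: integrable_fin_num.
Qed.

(** Both sides are measures in S, the mixtures of the laws Q1 w and Q2 w with
    density H. *)
Lemma mixture_eq (H : T -> R) (Q1 Q2 : T -> probability R R) :
  unit_mfun H ->
  (forall S, measurable S -> measurable_fun setT (fun w => Q1 w S)) ->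
  (forall S, measurable S -> measurable_fun setT (fun w => Q2 w S)) ->
  (forall t, \int[P]_w (H w * fine (Q1 w `]-oo, t]%classic)) =
             \int[P]_w (H w * fine (Q2 w `]-oo, t]%classic))) ->
  forall S, measurable S ->
    \int[P]_w (H w * fine (Q1 w S)) = \int[P]_w (H w * fine (Q2 w S)).
Proof.
move=> uH mQ1 mQ2 hray S mS.
have uQ (Q : T -> probability R R) A :
    (forall S, measurable S -> measurable_fun setT (fun w => Q w S)) ->
    measurable A -> unit_mfun (fun w => H w * fine (Q w A)).
  by move=> mQ mA; apply: unit_mfunM => //; apply: unit_mfun_kernel => //; exact: mQ.
pose K := [set A : set R | measurable A /\
  \int[P]_w (H w * fine (Q1 w A)) = \int[P]_w (H w * fine (Q2 w A))].
suff : <<s @rays R >> `<=` K.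
  by move=> h; move: mS; rewrite {1}measurable_rays => /h[].
apply: lambda_system_subset => //; first exact: setI_rays; last first.
  by move=> _ [t ->]; split => //; exact: measurable_itv.
split => //.
- by split => //; apply: eq_Rintegral => w _; rewrite !probability_setT.
- move=> A B BA [mA eA] [mB eB]; split; first exact: measurableD.
  have D (Q : T -> probability R R) :
      (forall S, measurable S -> measurable_fun setT (fun w => Q w S)) ->
      \int[P]_w (H w * fine (Q w (A `\` B))) =
      \int[P]_w (H w * fine (Q w A)) - \int[P]_w (H w * fine (Q w B)).
    move=> mQ; rewrite -RintegralB//; [|exact/unit_mfun_integrable/uQ..].
    apply: eq_Rintegral => w _.
    rewrite measureD//; last by rewrite (le_lt_trans (probability_le1 _ _))// ltry.
    by rewrite setIidr// fineB ?fin_num_measure// mulrBr.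
  by rewrite !D// eA eB.
- move=> F ndF KF; have mF n : measurable (F n) by have [] := KF n.
  have mU : measurable (\bigcup_n F n) by exact: bigcup_measurable.
  split => //.
  have D (Q : T -> probability R R) :
      (forall S, measurable S -> measurable_fun setT (fun w => Q w S)) ->
      \int[P]_w (H w * fine (Q w (F n))) @[n --> \oo] -->
      \int[P]_w (H w * fine (Q w (\bigcup_n F n))).
    move=> mQ; apply: (@bounded_Rintegral_cvg _ _ setT) => //.
    - by rewrite probability_setT.
    - by move=> n; exact: uQ.
    - exact: uQ.
    move=> w _; apply: cvgM; first exact: cvg_cst.
    apply: fine_cvg; rewrite fineK ?fin_num_measure//.
    exact: nondecreasing_cvg_mu.
  have := D Q1 mQ1.
  rewrite (_ : (fun n => \int[P]_w (H w * fine (Q1 w (F n)))) =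
    (fun n => \int[P]_w (H w * fine (Q2 w (F n))))); last first.
    by apply/funext => n; have [] := KF n.
  move=> h; exact: (cvg_unique _ h (D Q2 mQ2)).
Qed.

End bounded_integrals.

Lemma unit_mfun_comp d d' (T : measurableType d) (T' : measurableType d')
    (R : realType) (f : T' -> R) (g : T -> T') :
  measurable_fun setT g -> unit_mfun f -> unit_mfun (f \o g).
Proof.
by move=> mg [mf f01]; split => [|w]; [exact: measurableT_comp|exact: f01].
Qed.

(** * The empirical law directs an exchangeable sequence *)

Section de_finetti.
Context d (T : measurableType d) (R : realType) (P : probability T R).
Variables (X : nat -> T -> R) (tau : (nat -> nat) -> T -> T).
Hypothesis mX : forall i, measurable_fun setT (X i).
Hypothesis mtau : forall s, measurable_fun setT (tau s).
Hypothesis Ptau : forall s U, finite_perm s -> measurable U ->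
  P (tau s @^-1` U) = P U.
Hypothesis Xtau : forall s i w, X i (tau s w) = X (s i) w.

Let x (w : T) : nat -> R := fun i => X i w.

Lemma Rintegral_tau s (g : T -> R) : finite_perm s -> unit_mfun g ->
  \int[P]_w g (tau s w) = \int[P]_w g w.
Proof.
move=> fs [mg g01]; congr fine.
have g0 w : (0 <= (g w)%:E)%E by rewrite lee_fin; have /andP[] := g01 w.
have mEg : measurable_fun setT (EFin \o g) by apply/measurable_EFinP.
have := ge0_integral_pushforward (mtau s) P measurableT mEg (fun w _ => g0 w).
rewrite preimage_setT => <-.
by apply: eq_measure_integral => A mA _; exact: Ptau.
Qed.

Variables (Q : T -> probability R R) (C : set T).
Hypothesis mQ : forall S, measurable S -> measurable_fun setT (fun w => Q w S).
Hypothesis mC : measurable C.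
Hypothesis PC : P C = 1%E.
Hypothesis Qlim : forall w t, C w ->
  relfreq (x w) `]-oo, t]%classic n @[n --> \oo] --> fine (Q w `]-oo, t]%classic).

Lemma unit_mfun_relfreq S n : measurable S -> unit_mfun (fun w => relfreq (x w) S n).
Proof.
move=> mS; split; last by move=> w; rewrite relfreq_ge0 relfreq_le1.
rewrite (_ : (fun _ => _) = (fun w => (\sum_(i < n) (\1_S (X i w) : R)) / n%:R)).
  apply: measurable_funM => //; apply: measurable_sum => i.
  exact: (measurableT_comp (measurable_indic mS)).
by apply/funext => w; rewrite relfreqE.
Qed.

Lemma unit_mfun_indicX S i : measurable S -> unit_mfun (fun w => \1_S (X i w) : R).
Proof. by move=> mS; exact: (unit_mfun_comp (mX i) (unit_mfun_indic R mS)). Qed.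

Variables (H : T -> R) (k : nat).
Hypothesis uH : unit_mfun H.
Hypothesis Hinv : forall j w, (k <= j)%N -> H (tau (swap k j) w) = H w.

(** In the mean over the first n+1 terms, all those with index at least k have the
    same integral against H, and each of the other terms costs at most 1/(n+1). *)
Lemma Rintegral_relfreq_dist S n : measurable S ->
  `|\int[P]_w (H w * relfreq (x w) S n.+1) - \int[P]_w (H w * \1_S (X k w))| <=
  k%:R / n.+1%:R.
Proof.
move=> mS; have uX j : unit_mfun (fun w => H w * \1_S (X j w)).
  by apply: unit_mfunM => //; exact: unit_mfun_indicX.
pose c j := \int[P]_w (H w * \1_S (X j w)).
have c01 j : 0 <= c j <= 1.
  have [m01 h01] := uX j.
  rewrite Rintegral_ge0/=; last by move=> w _; have /andP[] := h01 w.
  have <- : \int[P]_w (cst 1 w) = 1 :> R 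
    by rewrite Rintegral_cst// mul1r; exact: (congr1 fine (probability_setT P)).
  apply: le_Rintegral => //; [exact: unit_mfun_integrable| |].
    exact: finite_measure_integrable_cst.
  by move=> w _; have /andP[] := h01 w.
(* Apply the transposition of k and j: it fixes H and turns x_j into x_k. *)
have ck j : (k <= j)%N -> c j = c k.
  move=> kj; rewrite /c -(Rintegral_tau (finite_perm_swap k j) (uX j)).
  apply: eq_Rintegral => w _; rewrite Hinv// Xtau /swap eqxx.
  by have [->|] := eqVneq j k.
have -> : \int[P]_w (H w * relfreq (x w) S n.+1) = (\sum_(j < n.+1) c j) / n.+1%:R.
  rewrite -(@Rintegral_sum _ _ _ P _ (index_enum 'I_n.+1)
    (fun (j : 'I_n.+1) w => H w * \1_S (X j w))); last first.
    by move=> j; exact: unit_mfun_integrable.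
  rewrite -RintegralZr//; last first.
    have := integrable_sum (measurableT : measurable [set: T])
      (index_enum 'I_n.+1) (P := xpredT) (fun j _ => unit_mfun_integrable P (uX j)).
    by apply: eq_integrable => // w _ /=; rewrite sumEFin.
  apply: eq_Rintegral => w _; rewrite relfreqE mulrA; congr (_ / _).
  by rewrite mulr_sumr.
have n0 : n.+1%:R != 0 :> R by rewrite pnatr_eq0.
have -> : (\sum_(j < n.+1) c j) / n.+1%:R - c k = (\sum_(j < n.+1) (c j - c k)) / n.+1%:R.
  by rewrite sumrB sumr_const card_ord mulrBl -[c k *+ _]mulr_natr mulfK.
rewrite normrM [`|_^-1|]ger0_norm ?invr_ge0// ler_pM2r ?invr_gt0//.
apply: (le_trans (ler_norm_sum _ _ _)).
apply: (@le_trans _ _ (\sum_(j < n.+1) (j < k)%N%:R)).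
  apply: ler_sum => j _; case: ltnP => [jk|/ck ->]; last by rewrite subrr normr0.
  have h1 := c01 j; have h2 := c01 k.
  by rewrite ler_norml /=; lra.
rewrite -natr_sum ler_nat -(big_mkord xpredT (fun j => (j < k)%N : nat)).
elim: n {n0} => [|n ih]; first by rewrite big_nat1; case: ltnP.
rewrite big_nat_recr//=; case: ltnP => nk; last by rewrite addn0.
rewrite addn1 (leq_ltn_trans _ nk)//.
rewrite (@leq_trans (\sum_(0 <= i < n.+1) 1)%N)//.
  by apply: leq_sum => i _; exact: leq_b1.
by rewrite sum_nat_const_nat subn0 muln1.
Qed.

(** For a ray S, the frequencies converge to Q w S, while their integrals against H
    converge to the left side; [mixture_eq] then extends the identity from rays. *)
Lemma Rintegral_directing_measure S : measurable S ->
  \int[P]_w (H w * \1_S (X k w)) = \int[P]_w (H w * fine (Q w S)).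
Proof.
move=> mS.
have := @mixture_eq _ _ _ P H (fun w => dirac (X k w) : probability R R) Q uH _ mQ _ S mS.
apply.
  move=> A mA; apply: (@measurableT_comp _ _ _ _ _ _ (fun y => @dirac _ _ y R A)) => //.
  exact: measurable_fun_dirac.
move=> t; have mt : measurable (`]-oo, t]%classic : set R) by exact: measurable_itv.
have lim1 : \int[P]_w (H w * relfreq (x w) `]-oo, t]%classic n.+1) @[n --> \oo] -->
    \int[P]_w (H w * fine (Q w `]-oo, t]%classic)).
  apply: (bounded_Rintegral_cvg mC PC).
  - by move=> n; apply: unit_mfunM => //; exact: unit_mfun_relfreq.
  - by apply: unit_mfunM => //; apply: unit_mfun_kernel => //; exact: mQ.
  move=> w Cw; apply: cvgM; first exact: cvg_cst.
  by have := @Qlim w t Cw; rewrite -cvg_shiftS.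
have lim2 : \int[P]_w (H w * relfreq (x w) `]-oo, t]%classic n.+1) @[n --> \oo] -->
    \int[P]_w (H w * \1_(`]-oo, t]%classic) (X k w)).
  apply/cvgrPdist_le => e e0.
  have [N hN] := ltr_add_invr (divr_gt0 e0 (ltr0Sn R k)).
  exists N => // n /= Nn; rewrite distrC (le_trans (Rintegral_relfreq_dist n mt))//.
  rewrite add0r in hN; apply: (@le_trans _ _ (k.+1%:R * N.+1%:R^-1)).
    by apply: ler_pM; rewrite ?ler_nat// lef_pV2 ?posrE// ler_nat.
  by rewrite mulrC -ler_pdivlMr// ltW.
exact: (cvg_unique _ lim2 lim1).
Qed.

End de_finetti.

(** * Empirical adequacy *)

Lemma eq_measure_prod (R : realType) d1 d2 (T1 : measurableType d1)
    (T2 : measurableType d2) (G : set (set T1))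
    (P1 P2 : probability (T1 * T2)%type R) :
  @measurable _ T1 = <<s G >> -> setI_closed G -> G setT ->
  (forall A B, G A -> measurable B -> P1 (A `*` B) = P2 (A `*` B)) ->
  forall U, measurable U -> P1 U = P2 U.
Proof.
move=> mE GI GT h U mU.
have oo (P : probability (T1 * T2)%type R) V : measurable V -> (P V < +oo)%E.
  by move=> mV; rewrite (le_lt_trans (probability_le1 _ _))// ltry.
pose G2 := [set V : set (T1 * T2) | exists A B,
  [/\ measurable A, measurable B & V = A `*` B]].
apply: (@eq_measure_pi R _ (T1 * T2)%type G2 P1 P2) => //.
- rewrite measurable_prod_measurableType; congr (<<s _ >>).
  apply/seteqP; split => [_ [A mA [B mB <-]]|_ [A [B [mA mB ->]]]].
    by exists A, B.
  by exists A => //; exists B.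
- move=> _ _ [A [B [mA mB ->]]] [A' [B' [mA' mB' ->]]].
  exists (A `&` A'), (B `&` B'); split; [exact: measurableI|exact: measurableI|].
  by rewrite setXI.
- by transitivity (1%E : \bar R); [|apply: esym]; exact: probability_setT.
- exact: oo.
move=> _ [A [B [mA mB ->]]].
have mT2B : measurable (setT `*` B : set (T1 * T2)) by exact: measurableX.
have mfst1 := @measurable_fst _ _ T1 T2.
pose m (P : probability (T1 * T2)%type R) : {measure set T1 -> \bar R} :=
  measure_function_pushforward__canonical__measure_function_Measure
    (mrestr P mT2B) mfst1.
have mPE (P : probability (T1 * T2)%type R) V : m P V = P (V `*` B).
  rewrite /m /= /pushforward /mrestr; congr (P _).
  by apply/seteqP; split => -[u v] /=; [move=> [? []]|move=> []].
suff : m P1 A = m P2 A by rewrite !mPE.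
apply: (@eq_measure_pi R _ T1 G (m P1) (m P2)) => //.
- by rewrite !mPE; exact: h.
- by rewrite mPE; apply: oo; exact: measurableX.
- by move=> V GV; rewrite !mPE; exact: h.
Qed.

Lemma product_dirac (R : realType) d1 d2 (T1 : measurableType d1)
    (T2 : measurableType d2) (Q1 : probability T1 R) (Q2 : probability T2 R)
    (a : T1) (b : T2) U :
  (forall S, measurable S -> Q1 S = \d_a S) ->
  (forall S, measurable S -> Q2 S = \d_b S) ->
  measurable U -> (Q1 \x Q2)%E U = \d_(a, b) U.
Proof.
move=> h1 h2 mU; apply: (product_measure_unique (m' := dirac (a, b))) => //.
move=> A B mA mB; transitivity (\d_a A * \d_b B : \bar R)%E; last first.
  by congr (_ * _)%E; apply/esym; [exact: h1|exact: h2].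
rewrite !diracE -EFinM -natrM mulnb; congr (_%:R%:E).
congr nat_of_bool; apply/idP/idP.
  by move=> /set_mem[/= Aa Bb]; rewrite !mem_set.
by move=> /andP[/set_mem Aa /set_mem Bb]; rewrite mem_set.
Qed.

Section adequacy.
Variables (R : realType) (A Y : mspace).
Let X := mreal R.
Variable f : pker R A (mprod (mpow X) Y).
Hypothesis exf : exchangeable1 f.
Variables (a : A) (da : dom f a).

Let P : probability (seqs X * Y)%type R := f a.
Let coord (i : nat) (w : seqs X * Y) : R := w.1 i.
Let tau (s : nat -> nat) (w : seqs X * Y) : seqs X * Y := (w.1 \o s, w.2).

Let mcoord i : measurable_fun setT (coord i).
Proof. exact: (measurableT_comp (@measurable_coord X i) measurable_fst). Qed.

Let mtau s : measurable_fun setT (tau s).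
Proof.
apply: measurable_fun_pair; last exact: measurable_snd.
by apply: measurable_to_seqs => i; exact: mcoord.
Qed.

Let D : set (seqs X * Y) := pts (mpow X) `*` pts Y.

Let mD : measurable D.
Proof. exact: (measurable_pts (mprod (mpow X) Y)). Qed.

Let PD : P D = 1%E.
Proof. exact: (ker_pts da). Qed.

Let Ptau s U : finite_perm s -> measurable U -> P (tau s @^-1` U) = P U.
Proof.
move=> fs mU; have [domE valE] := exf fs.
have da' : dom (Defs.pcomp (ptensor (pperm R X s) (pid R Y)) f) a by rewrite domE.
rewrite -[RHS](valE a da' U mU) pcompE//.
have mtU : measurable (tau s @^-1` U) by rewrite -[_ @^-1` _]setTI; exact: mtau.
transitivity (\int[P]_(w in D) (\1_(tau s @^-1` U) w)%:E)%E.
  by rewrite integral_indic//; apply/esym; exact: prob1_setI.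
apply: eq_integral => w _; apply/esym.
exact: (@product_dirac R _ _ (mpow X) Y (pperm R X s w.1) (pid R Y w.2)
  (w.1 \o s) w.2 U (fun _ _ => erefl) (fun _ _ => erefl) mU).
Qed.

Let C : set (seqs X * Y) := [set w | ecdf_cauchy w.1].

Let mC : measurable C.
Proof.
rewrite -[C]setTI; apply: (@measurable_fst _ _ (seqs X) Y) => //.
exact: measurable_ecdf_cauchy.
Qed.

Let PC : P C = 1%E.
Proof.
exact: (@exchangeable_ecdf_cauchy _ _ R P coord tau mcoord Ptau
  (fun _ _ _ => erefl) mC).
Qed.

Let Q (w : seqs X * Y) : probability R R := empirical_law w.1.

Let mQ S : measurable S -> measurable_fun setT (fun w => Q w S).
Proof.
move=> mS; apply: (measurableT_comp (measurable_empirical_lawT mS)).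
exact: measurable_fst.
Qed.

Let Qlim w t : C w ->
  relfreq (fun i => coord i w) `]-oo, t]%classic n @[n --> \oo] -->
  fine (Q w `]-oo, t]%classic).
Proof.
move=> Cw; have iT : is_interval (`]-oo, t]%classic : set R).
  exact: interval_is_interval.
have := empirical_lawP Cw iT; rewrite -[X in _ --> X]fineK.
  exact: fine_cvg.
by rewrite fin_num_measure//; exact: measurable_itv.
Qed.

Let Qtau w s S : finite_perm s -> measurable S -> Q (tau s w) S = Q w S.
Proof. by move=> fs mS; exact: empirical_law_perm. Qed.

Let uQ S : measurable S -> unit_mfun (fun w => fine (Q w S)).
Proof. by move=> mS; apply: unit_mfun_kernel => //; exact: mQ. Qed.

Let uX S i : measurable S -> unit_mfun (fun w => \1_S (coord i w) : R).
Proof. exact: (unit_mfun_indicX mcoord). Qed.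

Let uB (B : set Y) : measurable B ->
  unit_mfun (fun w : seqs X * Y => \1_B w.2 : R).
Proof.
by move=> mB; exact: (unit_mfun_comp measurable_snd (unit_mfun_indic R mB)).
Qed.

(** Change the factors one at a time.  When factor k is changed, those before it
    only involve coordinates below k and those after it only the empirical
    law, so that their product is invariant under the transpositions of k with
    larger indices. *)
Lemma directing_measure_product n (S : nat -> set R) (B : set Y) :
  (forall i, measurable (S i)) -> measurable B ->
  \int[P]_w (\1_B w.2 * \prod_(i < n) fine (Q w (S i))) =
  \int[P]_w (\1_B w.2 * \prod_(i < n) \1_(S i) (coord i w)).
Proof.
move=> mS mB.
pose g k i w : R := if (i < k)%N then \1_(S i) (coord i w) else fine (Q w (S i)).
have ug k i : unit_mfun (g k i).
  by rewrite /g; case: (i < k)%N; [exact: uX|exact: uQ].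
(* In J k the first k factors are indicators and the others empirical masses. *)
pose J k := \int[P]_w (\1_B w.2 * \prod_(i < n) g k i w).
suff JE k : (k <= n)%N -> J k = J 0%N.
  transitivity (J 0%N); first by apply: eq_Rintegral.
  rewrite -(JE n)//; apply: eq_Rintegral => w _; congr (_ * _).
  by apply: eq_bigr => i _; rewrite /g ltn_ord.
elim: k => // k ih kn; rewrite -ih; last exact: ltnW.
pose k' := Ordinal kn.
pose H w : R := \1_B w.2 * \prod_(i < n | i != k') g k i w.
have uH : unit_mfun H.
  by apply: unit_mfunM; [exact: uB|apply: unit_mfun_prod => i; exact: ug].
have Hinv j w : (k <= j)%N -> H (tau (swap k j) w) = H w.
  move=> kj; congr (_ * _); apply: eq_bigr => i ik.
  rewrite /g; case: ltnP => ik'.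
    by congr (\1_(S i) _); rewrite /coord /tau /= /swap !ltn_eqF// (leq_trans ik').
  by congr fine; apply: Qtau => //; exact: finite_perm_swap.
have h := @Rintegral_directing_measure _ _ R P coord tau mcoord mtau Ptau
  (fun _ _ _ => erefl) Q C mQ mC PC Qlim H k uH Hinv (S k) (mS k).
 transitivity (\int[P]_w (H w * \1_(S k) (coord k w))).
  apply: eq_Rintegral => w _; rewrite /H (bigD1 k')//= {1}/g ltnSn.
  rewrite mulrCA mulrC; congr (_ * _ * _); apply: eq_bigr => i ik; rewrite /g ltnS.
  have ik' : (i != k :> nat) by [].
  by rewrite leq_eqVlt (negbTE ik').
rewrite h; apply: eq_Rintegral => w _; rewrite /H [in RHS](bigD1 k')//= {2}/g ltnn.
by rewrite [in RHS]mulrCA mulrC.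
Qed.

Lemma adequacy_dom : f a (dom (ptensor (es_real_pow R) (pid R Y))) = 1%E.
Proof.
rewrite (_ : dom _ = (C `&` D : set (mprod (mpow X) Y))).
  by rewrite (prob1_setI mC mD PD).
apply/seteqP; split => -[x y] /=.
  by move=> [/esR_dom_cauchy cx yY]; split => //; split.
by move=> [cx [_ yY]]; split => //=; exact/esR_dom_cauchy.
Qed.

(** On a cylinder times a measurable set B, the composite integrates the product
    of the empirical masses over B. *)
Lemma adequacy_eq U : measurable U ->
  Defs.pcomp (ptensor (es_real_pow R) (pid R Y)) f a U = f a U.
Proof.
apply: (@eq_measure_prod R _ _ _ _ (@rects X)
  (Defs.pcomp (ptensor (es_real_pow R) (pid R Y)) f a) (f a)
  (@measurable_rects X) (@setI_rects X) (@rects_setT X)).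
move=> _ B [n [S [mS ->]]] mB.
rewrite pcompE; last by split => //; exact: adequacy_dom.
have mR := measurable_rect n mS.
set E := dom _.
have mE : measurable E by exact: measurable_dom.
have PE : P E = 1%E by exact: adequacy_dom.
have mB' : measurable (setT `*` B : set (seqs X * Y)) by exact: measurableX.
pose G w : R := \1_B w.2 * \prod_(i < n) fine (Q w (S i)).
have uG : unit_mfun G.
  by apply: unit_mfunM; [exact: uB|apply: unit_mfun_prod => i; exact: uQ].
transitivity (\int[P]_(w in E) (G w)%:E)%E.
  apply: eq_integral => w /set_mem Ew /=.
  rewrite product_measure1E//= empirical_iprodP// diracE /G muleC EFinM; congr (_ * _)%E.
  rewrite -prodEFin; apply: eq_bigr => i _; rewrite fineK// fin_num_measure//.
transitivity (\int[P]_w (G w)%:E)%E.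
  rewrite -[in LHS](setCK E) -setTD; apply/esym; apply: ge0_negligible_integral => //.
  - exact: measurableC.
  - by apply/measurable_EFinP; have [] := uG.
  - by move=> w _; rewrite lee_fin; have [_ /(_ w)/andP[]] := uG.
  - by have := probability_setC P mE; rewrite PE subee.
have RE (g : seqs X * Y -> R) : unit_mfun g ->
    (\int[P]_w (g w)%:E)%E = (\int[P]_w g w)%:E.
  move=> ug; rewrite /Rintegral fineK//.
  exact: (integrable_fin_num measurableT (unit_mfun_integrable P ug)).
have mRB : measurable (rect n S `*` B : set (seqs X * Y)) by exact: measurableX.
rewrite RE// directing_measure_product//.
transitivity (\int[P]_w (\1_(rect n S `*` B) w))%:E.
  congr EFin; apply: eq_Rintegral => w _; have [h|h] := pselect ((rect n S `*` B) w).
    rewrite [RHS]indicE mem_set//; case: h => wS wB.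
    rewrite big1 => [|i _]; first by rewrite mulr1 indicE mem_set.
    by rewrite indicE mem_set//; exact: wS.
  rewrite [RHS]indicE memNset//=; have [wB|wB] := pselect (B w.2); last first.
    by rewrite indicE memNset// mul0r.
  have [i wi] : exists i : 'I_n, ~ S i (coord i w).
    apply: contrapT => /forallNP hS; apply: h; split => // i iln.
    exact: (contrapT (hS (Ordinal iln))).
  by rewrite (bigD1 i)//= [\1_(S i) _]indicE memNset// mul0r mulr0.
rewrite -RE; last exact: unit_mfun_indic.
by rewrite integral_indic ?setIT.
Qed.

End adequacy.

Lemma es_real_empirically_adequate (R : realType) :
  empirically_adequate (es_real R).
Proof.
exists (es_real_pow R); first exact: is_ppow_es_real.
move=> A Y _ _ f exf; split.
  apply/seteqP; split => a; first by case.
  by move=> da; split => //; exact: adequacy_dom.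
by move=> a [da _] U mU; exact: adequacy_eq.
Qed.

Theorem theorem3p10 (R : realType) :
  (forall x : mpow (mreal R), esR_dom x ->
     exists2 mu : probability (mreal R) R, esR_measure x mu &
       forall nu : probability (mreal R) R, esR_measure x nu ->
         forall S : set R, measurable S -> nu S = mu S) /\
  exists2 es : pker R (mpow (mreal R)) (mreal R),
    is_esR es & empirical_sampling es.
Proof.
split; first by move=> x; exact: esR_measure_exists_unique.
exists (es_real R); first exact: is_esR_es_real.
split; first exact: es_real_permutation_invariant.
exact: es_real_empirically_adequate.
Qed.
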